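(* There exist universal constants $C,c>0$ such that the following holds. Let $\xi$ be a non-degenerate real random variable that is centered and sub-Gaussian, let $n\in\mathbb{N}$, let $\mathbf{x}=(X_1,\dots,X_n)^\top$ have i.i.d. components distributed as $\xi$, let $\mathbf{y}=\mathbf{x}/\|\mathbf{x}\|_2$, let $\mathbf{A}\in\mathbb{R}^{n\times n}$ be a (deterministic) matrix, and let $Q_n(\mathbf{y},\mathbf{A})=\mathbf{y}^\top\mathbf{A}\mathbf{y}$. Then for any $t>0$, $$\mathbb{P}\Big(\big|Q_n(\mathbf{y},\mathbf{A})-\mathbb{E}[Q_n(\mathbf{y},\mathbf{A})]\big|\ge t\Big)\le C\exp\left(-c\min\left(\frac{nt^2}{K^4\|\mathbf{A}\|^2},\ \frac{nt}{K^2\|\mathbf{A}\|}\right)\right),$$ where $K=\|\xi\|_{\psi_2}/\sqrt{\operatorname{Var}(\xi)}$.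
   Context: $\|\mathbf{A}\|$ is the operator (spectral) norm and $\|\cdot\|_2$ the Euclidean norm. The sub-Gaussian norm of a real random variable $Z$ is $\|Z\|_{\psi_2}=\inf\{v>0:\mathbb{E}[\psi_2(|Z|/v)]\le1\}$ with $\psi_2(x)=\exp(x^2)-1$; $Z$ is sub-Gaussian if $\|Z\|_{\psi_2}<\infty$. *)

(* Defs.v *)
From HB Require Import structures.
From mathcomp Require Import all_boot all_order all_algebra.
From mathcomp Require Import all_classical all_reals all_analysis.

Set Implicit Arguments.
Unset Strict Implicit.
Unset Printing Implicit Defensive.

Import Order.TTheory GRing.Theory Num.Theory.
Import numFieldNormedType.Exports.

Local Open Scope classical_set_scope.
Local Open Scope ring_scope.

(* The library's norm on 'cV[R]_n and 'M[R]_n is the entrywise maximum, hence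
   the explicit Euclidean and operator norms. *)
Definition l2norm (R : realType) (n : nat) (v : 'cV[R]_n) : R :=
  Num.sqrt (\sum_i v i 0 ^+ 2).

Definition opnorm (R : realType) (n : nat) (A : 'M[R]_n) : R :=
  sup [set l2norm (A *m v) | v in [set v : 'cV[R]_n | l2norm v <= 1]].

Definition psi2 (R : realType) (x : R) : R := expR (x ^+ 2) - 1.

Definition psi2_norm d (T : measurableType d) (R : realType)
    (P : probability T R) (Z : T -> R) : \bar R :=
  ereal_inf [set v%:E | v in
    [set v : R | 0 < v /\ ('E_P[fun w => psi2 (`|Z w| / v)] <= 1)%E]].

Definition subgaussian d (T : measurableType d) (R : realType)
    (P : probability T R) (Z : T -> R) : Prop := (psi2_norm P Z < +oo)%E.

Definition nondegenerate_rv d (T : measurableType d) (R : realType)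
    (P : probability T R) (Z : T -> R) : Prop :=
  ~ exists a : R, {ae P, forall w, Z w = a}.

Definition same_distribution d (T : measurableType d) d'
    (T' : measurableType d') (R : realType) (P : probability T R)
    (P' : probability T' R) (X : {RV P >-> R}) (Y : {RV P' >-> R}) : Prop :=
  forall B : set R, measurable B -> distribution P X B = distribution P' Y B.

Definition mutually_independent d (T : measurableType d) (R : realType)
    (P : probability T R) (I : finType) (X : I -> {RV P >-> R}) : Prop :=
  forall (J : {set I}) (B : I -> set R), (forall i, measurable (B i)) ->
    P (\bigcap_(i in [set` J]) (X i @^-1` B i)) =
    (\prod_(i in J) P (X i @^-1` B i))%E.

Definition rvec d (T : measurableType d) (R : realType) (P : probability T R)
    (n : nat) (X : 'I_n -> {RV P >-> R}) (w : T) : 'cV[R]_n :=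
  \col_i X i w.

(* Since 0^-1 = 0, this is the zero vector at v = 0. *)
Definition normalize (R : realType) (n : nat) (v : 'cV[R]_n) : 'cV[R]_n :=
  (l2norm v)^-1 *: v.

Definition quad_form (R : realType) (n : nat) (A : 'M[R]_n) (v : 'cV[R]_n) : R :=
  (v^T *m A *m v) 0 0.

(* Both values are finite when Z is centered and sub-Gaussian. *)
Definition psi2_ratio d (T : measurableType d) (R : realType)
    (P : probability T R) (Z : T -> R) : R :=
  fine (psi2_norm P Z) / Num.sqrt (fine 'V_P[Z]).

(* Main.v *)
Require Import Defs.
From HB Require Import structures.
From mathcomp Require Import all_boot all_order all_algebra.
From mathcomp Require Import all_classical all_reals all_analysis.
From mathcomp Require Import measurable_realfun ring lra.

Import Order.TTheory GRing.Theory Num.Theory.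
Import numFieldNormedType.Exports.

Local Open Scope classical_set_scope.
Local Open Scope ring_scope.

(* Put a = tr A / n.  The event Q - a >= t is contained in the event that the
   quadratic form of M = A - (a + t) I is nonnegative at x, and tr M = - t n; so
   one exponential moment bound for x^T M x - Var(xi) tr M yields the tail of
   Q - a, without separate control of |x|_2.  This moment is split into diagonal
   and off-diagonal parts.  The off-diagonal part is 4 times the average, over
   the subsets S of the indices, of the sum of the x_i M_ij x_j with i outside S
   and j in S; Jensen's inequality reduces it to a fixed S.  Integrating out the
   x_i outside S leaves the exponential moment of a multiple of |M x_S|^2; there
   M may be replaced by A, and |A x_S|^2 <= |A|^2 |x|^2 is, up to the factor
   |A|^2, a sum of independent terms.  Finally the sub-Gaussian tail of Q - a
   around 0 gives |E Q - a| = O(K^2 |A| / sqrt n), a shift that is absorbed by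
   the constant C. *)

(** * Independence and partial integration *)

Section independence.
Local Open Scope ereal_scope.
Context {d} {T : measurableType d} {R : realType} {P : probability T R}.

(** The law of [(Y, X)] agrees with the product of the marginal laws on rectangles, hence
    everywhere, and Tonelli's theorem splits the integral. [X] is the second component so that it
    ends up in the inner integral. *)
Lemma ge0_integral_indep d1 d2 (T1 : measurableType d1)
    (T2 : measurableType d2) (X : {RV P >-> T1}) (Y : {RV P >-> T2})
    (f : T2 * T1 -> \bar R) :
  (forall A B, measurable A -> measurable B ->
    P (X @^-1` A `&` Y @^-1` B) = P (X @^-1` A) * P (Y @^-1` B)) ->
  measurable_fun setT f -> (forall z, 0 <= f z) ->
  \int[P]_w f (Y w, X w) = \int[P]_w \int[P]_u f (Y w, X u).
Proof.
move=> indep mf f0.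
have mYX : measurable_fun setT (fun w => (Y w, X w)).
  exact/measurable_fun_pair.
pose YX : {mfun T >-> (T2 * T1)%type} :=
  HB.pack (fun w => (Y w, X w)) (@isMeasurableFun.Build _ _ _ _ _ mYX).
have -> : \int[P]_w f (Y w, X w) = \int[distribution P YX]_z f z.
  by rewrite ge0_integral_distribution.
have eqm A : measurable A -> A `<=` setT ->
    distribution P YX A = (distribution P Y \x distribution P X)%E A.
  move=> mA _; apply/esym/product_measure_unique => // B C mB mC.
  rewrite muleC -indep// setIC.
  by congr (P _); apply/seteqP; split => w.
rewrite (eq_measure_integral _ eqm) fubini_tonelli1//.
rewrite ge0_integral_distribution//=.
- apply: eq_integral => w _; rewrite /fubini_F.
  by rewrite ge0_integral_distribution//; exact: measurableT_comp.
- exact: measurable_fun_fubini_tonelli_F.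
- by move=> y; apply: integral_ge0.
Qed.

Context {I : finType} (X : I -> {RV P >-> R}).

(** These cylinders form a pi-system that generates the sigma-algebra of the [X i] with [i != j].
    Measurability on [off_type j] thus encodes being a function of the variables other than
    [X j]. *)
Definition cylinders_off (j : I) : set (set T) :=
  [set A | exists2 B : I -> set R, (forall i, measurable (B i)) &
    A = \bigcap_(i in [set` [set~ j]%SET]) (X i @^-1` B i)].

Definition off_type j := g_sigma_algebraType (cylinders_off j).

Lemma measurable_off j i : i != j ->
  measurable_fun setT (X i : off_type j -> R).
Proof.
move=> ij _ B mB; rewrite setTI; apply: sub_sigma_algebra => /=.
exists (fun k => if k == i then B else setT).
  by move=> k; case: ifP.
apply/seteqP; split => [w Xw k|w]; rewrite /=.
  by case: (eqVneq k i) => // ->.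
by move=> /(_ i); rewrite /= eqxx; apply; rewrite !inE.
Qed.

Lemma cylinders_off_measurable j : cylinders_off j `<=` measurable.
Proof.
move=> _ [B mB ->]; apply: fin_bigcap_measurable; first exact: finite_finset.
by move=> i _; rewrite -[_ @^-1` _]setTI; exact: measurable_funP.
Qed.

Lemma measurable_id_off j : measurable_fun setT (id : T -> off_type j).
Proof.
move=> _ B mB; rewrite setTI preimage_id.
have := @smallest_sub _ _ _ _ (@sigma_algebra_measurable _ T)
  (@cylinders_off_measurable j).
exact.
Qed.

Lemma measurable_off_measurable j (f : T -> R) :
  measurable_fun setT (f : off_type j -> R) -> measurable_fun setT f.
Proof. by move=> mf; exact: (measurableT_comp mf (measurable_id_off j)). Qed.

End independence.

(** * Integrating out a single independent variable *)

Section integrate_out.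
Local Open Scope ereal_scope.
Context {d} {T : measurableType d} {R : realType} {P : probability T R}.
Context {I : finType} {X : I -> {RV P >-> R}} (indX : mutually_independent X).

Lemma cylinders_off_setI j : setI_closed (cylinders_off X j).
Proof.
move=> _ _ [B mB ->] [C mC ->]; exists (fun i => B i `&` C i).
  by move=> i; exact: measurableI.
apply/seteqP; split => [w [Bw Cw] i ij|w BCw]; first by split; [exact: Bw|exact: Cw].
by split => i ij; have [] := BCw i ij.
Qed.

(** Mutual independence is applied once to all indices and once to those other than [j]; the two
    products differ by the factor of [j]. *)
Lemma indep_cylinder_off j A B : measurable A -> cylinders_off X j B ->
  P (X j @^-1` A `&` B) = P (X j @^-1` A) * P B.
Proof.
move=> mA [C mC ->].
pose D i := if i == j then A else C i.
have mD i : measurable (D i) by rewrite /D; case: ifP.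
have -> : X j @^-1` A `&` \bigcap_(i in [set` [set~ j]%SET]) (X i @^-1` C i) =
    \bigcap_(i in [set` [set: I]%SET]) (X i @^-1` D i).
  apply/seteqP; split => [w [Aw Cw] i _|w Dw]; rewrite /preimage /D /=.
    by case: eqVneq => [-> //|ij]; apply: Cw; rewrite /= !inE.
  split=> [|i /=]; first by have /= := Dw j; rewrite /preimage /D eqxx inE; apply.
  by rewrite !inE => /negPf ij; have /= := Dw i; rewrite /preimage /D ij inE; apply.
rewrite (indX _ _ mD) (indX _ _ mC) (bigD1 j) ?inE//=; congr (_ * _).
  by rewrite /D eqxx.
apply: eq_big => [i|i]; first by rewrite !inE.
by rewrite /D inE => /andP[_ /negPf ->].
Qed.

(** For fixed [A] both sides are finite measures in [B]: a restriction and a multiple of [P]. They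
    agree on the pi-system of cylinders, hence on the sigma-algebra that it generates. *)
Lemma indep_off j A (B : set (off_type X j)) : measurable A -> measurable B ->
  P (X j @^-1` A `&` B) = P (X j @^-1` A) * P B.
Proof.
move=> mA mB.
have mXA : measurable (X j @^-1` A).
  by rewrite -[_ @^-1` _]setTI; exact: measurable_funP.
have fXA : P (X j @^-1` A) \is a fin_num by exact: fin_num_measure.
have r0 : (0 <= fine (P (X j @^-1` A)))%R by exact: fine_ge0.
rewrite setIC -[P (B `&` _)]/(mrestr P mXA B) -(fineK fXA).
rewrite -[RHS]/(mscale (NngNum r0) P B).
apply: (@g_sigma_algebra_measure_unique _ _ _ (cylinders_off X j) _ (fun=> setT)) => //.
- exact: cylinders_off_measurable.
- move=> _; exists (fun=> setT) => //.
  by apply/seteqP; split.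
- by rewrite bigcup_const.
- exact: cylinders_off_setI.
- move=> C CC; have := indep_cylinder_off _ _ _ mA CC.
  by rewrite setIC -{1}(fineK fXA).
- by move=> _; rewrite -ge0_fin_numE// /= /mrestr setTI.
Qed.

(* The variable [X j] is integrated out first, the functions [G] and [H] of the
   remaining variables being frozen. *)
Lemma le_integrate_out j (f : R -> R -> R) (phi : R -> R) (G H : T -> R) :
  measurable_fun setT (fun z : R * R => f z.1 z.2) ->
  (forall x g, 0 <= f x g)%R ->
  measurable_fun setT phi -> (forall g, 0 <= phi g)%R ->
  (forall g, \int[P]_w (f (X j w) g)%:E <= (phi g)%:E) ->
  measurable_fun setT (G : off_type X j -> R) ->
  measurable_fun setT (H : off_type X j -> R) ->
  (forall w, 0 <= H w)%R ->
  \int[P]_w (H w * f (X j w) (G w))%:E <= \int[P]_w (H w * phi (G w))%:E.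
Proof.
move=> mf f0 mphi phi0 fphi mG mH H0.
(* The identity into the coarser space is a single random element carrying all the variables except
   [X j]. *)
pose Y : {RV P >-> off_type X j} :=
  HB.pack (id : T -> off_type X j)
    (@isMeasurableFun.Build _ _ _ _ _ (measurable_id_off X j)).
pose F (z : off_type X j * R) := (H z.1 * f z.2 (G z.1))%:E.
have mF : measurable_fun setT F.
  apply/measurable_EFinP/measurable_funM; first exact: measurableT_comp.
  apply: (measurableT_comp (f := fun z : R * R => f z.1 z.2)
    (g := fun z : off_type X j * R => (z.2, G z.1))) => //.
  by apply/measurable_fun_pair => //=; exact: measurableT_comp.
have F0 z : 0 <= F z by rewrite lee_fin mulr_ge0.
have := @ge0_integral_indep _ _ _ P _ _ _ _ (X j) Y F _ mF F0.
rewrite /F /= => ->; last by move=> A B mA mB; exact: indep_off.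
apply: ge0_le_integral => //.
- by move=> w _; apply: integral_ge0 => u _; rewrite lee_fin mulr_ge0.
- have mY : measurable_fun setT (fubini_F (distribution P (X j)) F).
    exact: measurable_fun_fubini_tonelli_F.
  apply: (eq_measurable_fun (fun w => fubini_F (distribution P (X j)) F (Y w))).
    move=> w _; rewrite /fubini_F ge0_integral_distribution//.
    exact: measurableT_comp.
  exact: (measurableT_comp mY).
- apply/measurable_EFinP/measurable_funM; first exact: measurable_off_measurable mH.
  by apply: (measurableT_comp mphi); exact: measurable_off_measurable mG.
- move=> w _; under eq_integral do rewrite EFinM.
  rewrite ge0_integralZl//.
  + by rewrite EFinM lee_wpmul2l// lee_fin.
  + apply/measurable_EFinP.
    apply: (measurableT_comp (f := fun z : R * R => f z.1 z.2)
       (g := fun u => (X j u, G w))) => //.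
    exact/measurable_fun_pair.
  + by move=> u _; rewrite lee_fin.
  + by rewrite lee_fin.
Qed.

End integrate_out.

(** * One-dimensional exponential moments *)

Section exponential_inequalities.
Context {R : realType}.
Implicit Types x z tau mu : R.

(** The term [x] disappears when a centered variable is integrated. On the middle range the bound
    comes from [1 / (1 - x) <= 1 + x + 2 x^2]; outside it, [2 x^2] dominates [|x|]. *)
Lemma expR_le_addr_sqr x : expR x <= x + expR (2 * x ^+ 2).
Proof.
have le2 : 1 + 2 * x ^+ 2 <= expR (2 * x ^+ 2) by exact: expR_ge1Dx.
have [x_gt|x_le] := ltP (2^-1) x.
  have : expR x <= expR (2 * x ^+ 2) by rewrite ler_expR; nra.
  by lra.
have [x_lt|x_ge] := ltP x (- 2^-1).
  have : expR x <= 1 by rewrite expR_le1; lra.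
  by nra.
have d_gt0 : 0 < 1 - x by lra.
have : expR x <= (1 - x)^-1.
  rewrite -[x in expR x]opprK expRN lef_pV2 ?posrE ?expR_gt0//.
  exact: expR_ge1Dx.
have : (1 - x)^-1 <= 1 + x + 2 * x ^+ 2.
  rewrite -[leLHS]mul1r ler_pdivrMr//.
  by nra.
by lra.
Qed.

(** Convexity of the exponential: its tangent at [mu * z] lies below it at 0 ([h1]) and at [z]
    ([h2]), and the weights [1 - mu] and [mu] cancel the slope. *)
Lemma expR_le_interpol mu z : 0 <= mu <= 1 ->
  expR (mu * z) <= (1 - mu) + mu * expR z.
Proof.
move=> /andP[mu0 mu1].
set e := expR (mu * z); have e0 : 0 < e by exact: expR_gt0.
have h1 : e * (1 - mu * z) <= 1.
  rewrite -[leRHS](expRxMexpNx_1 (mu * z)) ler_pM2l//.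
  by have := expR_ge1Dx (- (mu * z)); lra.
have h2 : e * (1 + (1 - mu) * z) <= expR z.
  have -> : expR z = e * expR ((1 - mu) * z) by rewrite -expRD; congr expR; ring.
  by rewrite ler_pM2l// expR_ge1Dx.
have := ler_wpM2l mu0 h2.
have mu1' : 0 <= 1 - mu by lra.
have := ler_wpM2l mu1' h1.
by nra.
Qed.

Lemma sqr_le_expR z : 0 <= z -> z ^+ 2 <= 4 * (expR z - 1).
Proof.
move=> z0; have -> : expR z = expR (z / 2) ^+ 2.
  by rewrite -expRM_natl; congr expR; field.
have : 1 + z / 2 <= expR (z / 2) by exact: expR_ge1Dx.
by nra.
Qed.

(** A second-order expansion whose remainder keeps the factor [tau ^+ 2] and is integrable as soon
    as [expR z] is. While [tau * z] is at most 1/2 it follows from [1 / (1 - u) <= 1 + u + 2 u^2];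
    beyond, the remainder alone dominates [expR (tau * z)]. *)
Lemma expR_le_quadratic tau z : `|tau| <= 2^-1 -> 0 <= z ->
  expR (tau * z) <= 1 + tau * z + 64 * tau ^+ 2 * (expR z - 1).
Proof.
rewrite ler_norml => /andP[tau_ge tau_le] z0.
have ez1 : 0 <= expR z - 1 by have := expR_ge1Dx z; lra.
have [small|big] := leP (tau * z) 2^-1.
  have : expR (tau * z) <= 1 + tau * z + 2 * (tau * z) ^+ 2.
    have d_gt0 : 0 < 1 - tau * z by lra.
    have le1 : expR (tau * z) <= (1 - tau * z)^-1.
      rewrite -[X in expR X]opprK expRN lef_pV2 ?posrE ?expR_gt0//.
      exact: expR_ge1Dx.
    apply: (le_trans le1).
    rewrite -[leLHS]mul1r ler_pdivrMr//.
    by nra.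
  have := ler_wpM2l (sqr_ge0 tau) (sqr_le_expR _ z0).
  have := mulr_ge0 (sqr_ge0 tau) ez1.
  by rewrite exprMn; nra.
have tau0 : 0 < tau by rewrite ltNge; apply/negP => ?; nra.
have e0 := expR_gt0 (tau * z).
(* z >= 1 / (2 tau), so the factor e^((1 - tau) z) exceeds 1 by at least
   1 / (64 tau^2) *)
have h1 : 1 + z ^+ 2 / 16 <= expR ((1 - tau) * z).
  have -> : expR ((1 - tau) * z) = expR ((1 - tau) * z / 2) ^+ 2.
    by rewrite -expRM_natl; congr expR; field.
  have : 1 + (1 - tau) * z / 2 <= expR ((1 - tau) * z / 2) by exact: expR_ge1Dx.
  have : z / 4 <= (1 - tau) * z / 2 by nra.
  by set E := expR _; nra.
have -> : expR z = expR (tau * z) * expR ((1 - tau) * z).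
  by rewrite -expRD; congr expR; ring.
have := ler_wpM2l (ltW e0) h1.
set e := expR (tau * z) in e0 *; set f := expR (_ * z).
move=> h2.
have h3 : e / 64 <= tau ^+ 2 * (e * f - e).
  have : 2^-2 <= (tau * z) ^+ 2 by nra.
  rewrite exprMn => h4.
  have := ler_wpM2l (sqr_ge0 tau) h2.
  have := ler_wpM2l (ltW e0) h4.
  by lra.
have e1 : 1 <= e by have := expR_ge1Dx (tau * z); rewrite -/e; nra.
have := mulr_ge0 (sqr_ge0 tau) (_ : 0 <= e - 1); rewrite subr_ge0 => /(_ e1).
by nra.
Qed.

End exponential_inequalities.

(** * Exponential moments of a variable whose psi2 norm is at most [v] *)

Section one_dimensional.
Local Open Scope ereal_scope.
Context {d} {T : measurableType d} {R : realType} {P : probability T R}.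

Lemma integral_probability_cst (a : R) : \int[P]_w a%:E = a%:E.
Proof. by have := expectation_cst P a; rewrite unlock. Qed.

(** The coefficient [b] may have either sign, so the mean of [Y] is given exactly; for [W], with [c]
    nonnegative, an upper bound is enough. *)
Lemma integral_le_affine (Y W F : T -> R) (a b c m k : R) :
  P.-integrable setT (EFin \o Y) -> \int[P]_w (Y w)%:E = m%:E ->
  P.-integrable setT (EFin \o W) -> \int[P]_w (W w)%:E <= k%:E ->
  (0 <= c)%R -> measurable_fun setT F -> (forall w, 0 <= F w)%R ->
  (forall w, F w <= a + b * Y w + c * W w)%R ->
  \int[P]_w (F w)%:E <= (a + b * m + c * k)%:E.
Proof.
move=> iY EY iW EW c0 mF F0 leF.
have ia : P.-integrable setT (EFin \o cst a).
  exact: finite_measure_integrable_cst.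
have ibY := integrableZl measurableT b iY.
have icW := integrableZl measurableT c iW.
have iabY := integrableD measurableT ia ibY.
have iall := integrableD measurableT iabY icW.
apply: (@le_trans _ _ (\int[P]_w
    (a%:E + b%:E * (Y w)%:E + c%:E * (W w)%:E))).
  apply: ge0_le_integral => //.
  - by move=> w _; rewrite lee_fin.
  - exact/measurable_EFinP.
  - exact: measurable_int iall.
  - by move=> w _; rewrite -!EFinM -!EFinD lee_fin.
rewrite (integralD measurableT iabY icW) (integralD measurableT ia ibY).
rewrite (integralZl measurableT iY) (integralZl measurableT iW).
have -> : \int[P]_w ((EFin \o cst a) w) = a%:E.
  exact: integral_probability_cst.
rewrite EY.
by rewrite !EFinD !EFinM leeD2l// lee_wpmul2l// lee_fin.
Qed.

Context {Z : {RV P >-> R}} {v : R} (v0 : (0 < v)%R).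
Hypothesis expZ : \int[P]_w (expR ((Z w / v) ^+ 2))%:E <= 2%:E.

Let mZv : measurable_fun setT (fun w => (Z w / v) ^+ 2)%R.
Proof. by apply: measurable_funX; exact: measurable_funM. Qed.

Lemma integrable_expR_sqr mu : (0 <= mu <= 1)%R ->
  P.-integrable setT (EFin \o (fun w => expR (mu * (Z w / v) ^+ 2))).
Proof.
move=> /andP[mu0 mu1]; apply/integrableP; split.
  apply/measurable_EFinP; apply: measurableT_comp => //.
  exact: measurable_funM.
apply: (@le_lt_trans _ _ 2%:E); last exact: ltry.
apply: le_trans expZ; apply: ge0_le_integral => //.
- by apply/measurable_EFinP/measurableT_comp => //; apply: measurableT_comp => //;
     exact: measurable_funM.
- by apply/measurable_EFinP; apply: measurableT_comp.
- move=> w _ /=; rewrite ger0_norm ?expR_ge0// lee_fin ler_expR.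
  by rewrite ler_piMl// sqr_ge0.
Qed.

Lemma integrable_le_sqr (f : T -> R) (c : R) : measurable_fun setT f ->
  (forall w, `|f w| <= c * (1 + (Z w / v) ^+ 2))%R ->
  P.-integrable setT (EFin \o f).
Proof.
move=> mf lef.
have i1 := @integrable_expR_sqr 1%R.
rewrite ler01 lexx in i1; have := integrableZl measurableT c (i1 isT).
apply: le_integrable => //; first exact/measurable_EFinP.
move=> w _ /=; rewrite lee_fin mul1r.
apply: le_trans (lef w) _; apply: le_trans (ler_norm _) _.
rewrite !normrM ler_wpM2l// ger0_norm; last first.
  by rewrite addr_ge0// sqr_ge0.
by rewrite ger0_norm ?expR_ge0// expR_ge1Dx.
Qed.

(** Interpolating between the moments 1 (at [mu = 0]) and 2 (at [mu = 1]) gives [1 + mu]. *)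
Lemma mgf_sqr_le mu : (0 <= mu <= 1)%R ->
  \int[P]_w (expR (mu * (Z w / v) ^+ 2))%:E <= (expR mu)%:E.
Proof.
move=> mu01; have /andP[mu0 mu1] := mu01.
have i1 : P.-integrable setT (EFin \o (fun w => expR ((Z w / v) ^+ 2))).
  have := @integrable_expR_sqr 1%R; rewrite ler01 lexx => /(_ isT).
  by under eq_fun do rewrite mul1r.
(* The zero function takes the place of [Y] in [integral_le_affine], as there is no linear term
   here. *)
have i0 : P.-integrable setT (EFin \o (fun=> 0%R : R)).
  exact: finite_measure_integrable_cst.
have E0 : \int[P]_w ((fun=> 0%R : R) w)%:E = 0%:E by rewrite integral0.
have := @integral_le_affine _ _ (fun w => expR (mu * (Z w / v) ^+ 2))
   (1 - mu)%R 0%R mu _ _ i0 E0 i1 expZ mu0 _ _ _.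
have -> : (1 - mu + 0 * 0 + mu * 2 = 1 + mu)%R by ring.
move=> H; apply: le_trans (H _ _ _) _.
- by apply: measurableT_comp => //; exact: measurable_funM.
- by move=> w; exact: expR_ge0.
- by move=> w; rewrite mul0r addr0; exact: expR_le_interpol.
- by rewrite lee_fin expR_ge1Dx.
Qed.

Lemma integrable_rv : P.-integrable setT (EFin \o Z).
Proof.
apply: (@integrable_le_sqr _ v) => // w.
set z := (Z w / v)%R.
have -> : Z w = (v * z)%R by rewrite /z mulrC divfK// gt_eqF.
rewrite normrM gtr0_norm// ler_pM2l//.
by rewrite -[(z ^+ 2)%R]real_normK ?num_real//; have := normr_ge0 z; nra.
Qed.

(** For small [lam], [expR_le_addr_sqr] leaves the moment of a square, the linear term vanishing by
    centering. For large [lam], AM-GM gives [lam Z <= (lam v)^2 / 2 + (Z / v)^2 / 2], and the extra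
    factor [expR (1/2)] is absorbed because [2 lam^2 v^2 > 1]. *)
Lemma mgf_le (lam : R) : \int[P]_w (Z w)%:E = 0 ->
  \int[P]_w (expR (lam * Z w))%:E <= (expR (2 * lam ^+ 2 * v ^+ 2))%:E.
Proof.
move=> EZ; have mE : measurable_fun setT (fun w => expR (lam * Z w)).
  by apply: measurableT_comp => //; exact: measurable_funM.
have sq w : (lam * Z w = lam * v * (Z w / v))%R by field; rewrite gt_eqF.
have [small|big] := leP (2 * lam ^+ 2 * v ^+ 2)%R 1%R.
  have mu01 : (0 <= 2 * lam ^+ 2 * v ^+ 2 <= 1)%R.
    by rewrite small andbT -mulrA -exprMn mulr_ge0 ?sqr_ge0.
  have := @integral_le_affine _ _ (fun w => expR (lam * Z w)) 0%R lam 1%R _ _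
    integrable_rv EZ (integrable_expR_sqr _ mu01) (mgf_sqr_le _ mu01) ler01 mE _ _.
  rewrite mulr0 addr0 add0r mul1r; apply=> w; first exact: expR_ge0.
  rewrite add0r mul1r; apply: le_trans (expR_le_addr_sqr _) _.
  by rewrite {2}sq !exprMn !mulrA.
have mu01 : (0 <= (2^-1 : R) <= 1)%R by lra.
have := @integral_le_affine _ _ (fun w => expR (lam * Z w)) 0%R 0%R
    (expR (2^-1 * (lam * v) ^+ 2)) _ _
    integrable_rv EZ (integrable_expR_sqr _ mu01) (mgf_sqr_le _ mu01)
    (expR_ge0 _) mE _ _.
rewrite mulr0 add0r add0r -expRD => H; apply: le_trans (H _ _) _.
- by move=> w; exact: expR_ge0.
- move=> w; rewrite mul0r !add0r -expRD ler_expR sq.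
  by have := sqr_ge0 (lam * v - Z w / v); nra.
- by rewrite lee_fin ler_expR exprMn; lra.
Qed.

Lemma mgf_sqr_centered_le (tau s : R) : (`|tau| <= 2^-1)%R ->
  \int[P]_w ((Z w / v) ^+ 2)%:E = s%:E ->
  \int[P]_w (expR (tau * ((Z w / v) ^+ 2 - s)))%:E <= (expR (64 * tau ^+ 2))%:E.
Proof.
move=> tau2 Es.
have i1 : P.-integrable setT (EFin \o (fun w => expR ((Z w / v) ^+ 2))).
  have := @integrable_expR_sqr 1%R; rewrite ler01 lexx => /(_ isT).
  by under eq_fun do rewrite mul1r.
have iY : P.-integrable setT (EFin \o (fun w => (Z w / v) ^+ 2)%R).
  apply: (@integrable_le_sqr _ 1%R) => // w.
  by rewrite mul1r ger0_norm ?sqr_ge0//; lra.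
have mE : measurable_fun setT (fun w => expR (tau * (Z w / v) ^+ 2)).
  by apply: measurableT_comp => //; exact: measurable_funM.
have c0 : (0 <= 64 * tau ^+ 2)%R by rewrite mulr_ge0 ?sqr_ge0.
(* The [- 1] of the remainder is moved into the constant term, so that the moment bound 2 yields
   [1 + tau s + 64 tau^2] in all. *)
have := @integral_le_affine _ _ (fun w => expR (tau * (Z w / v) ^+ 2))
   (1 - 64 * tau ^+ 2)%R tau (64 * tau ^+ 2)%R _ _ iY Es i1 expZ c0 mE _ _.
move=> H; under eq_integral do rewrite mulrBr addrC expRD EFinM.
rewrite ge0_integralZl//; last exact/measurable_EFinP.
apply: (@le_trans _ _ ((expR (- (tau * s)))%:E * (expR (tau * s + 64 * tau ^+ 2))%:E)).
  rewrite lee_wpmul2l ?lee_fin ?expR_ge0//; apply: le_trans (H _ _) _.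
  - by move=> w; exact: expR_ge0.
  - move=> w; apply: le_trans (expR_le_quadratic _ _ tau2 (sqr_ge0 _)) _.
    by lra.
  - by rewrite lee_fin; apply: le_trans (expR_ge1Dx _); lra.
by rewrite -EFinM -expRD lee_fin ler_expR; lra.
Qed.

End one_dimensional.

(** * Exponential moments of quadratic forms *)

Section decoupling.
Context {R : realType} {I : finType}.
Implicit Types S : {set I}.

Let toggle (i : I) S := if i \in S then (S :\ i)%SET else (i |: S)%SET.

Let toggleK i : involutive (toggle i).
Proof.
move=> S; rewrite /toggle; case: (boolP (i \in S)) => iS.
  by rewrite !inE eqxx finset.setD1K.
by rewrite !inE eqxx finset.setU1K.
Qed.

Let in_toggle i j S : (j \in toggle i S) = (j == i) (+) (j \in S).
Proof.
by rewrite /toggle; case: ifP => iS; rewrite !inE; case: eqVneq => // ->;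
  rewrite iS.
Qed.

(* Toggling the membership of [i] or of [j] shows that the four possible
   memberships are equally frequent. *)
Lemma sum_separating_sets (i j : I) : i != j ->
  4 * \sum_(S : {set I}) ((i \notin S) && (j \in S))%:R = #|{set I}|%:R :> R.
Proof.
move=> ij.
pose N (a b : bool) : R := \sum_(S : {set I}) (((i \in S) == a) && ((j \in S) == b))%:R.
have Ni a b : N a b = N (~~ a) b.
  rewrite /N (reindex_inj (inv_inj (toggleK i))); apply: eq_bigr => S _.
  rewrite !in_toggle eqxx [j == i]eq_sym (negPf ij) /=.
  by case: a; case: (i \in S).
have Nj a b : N a b = N a (~~ b).
  rewrite /N (reindex_inj (inv_inj (toggleK j))); apply: eq_bigr => S _.
  rewrite !in_toggle eqxx (negPf ij) /=.
  by case: b; case: (j \in S).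
have -> : \sum_(S : {set I}) ((i \notin S) && (j \in S))%:R = N false true.
  by apply: eq_bigr => S _; case: (i \in S); case: (j \in S).
have : N false false + N false true + N true false + N true true = #|{set I}|%:R.
  rewrite -!big_split /= -sum1_card natr_sum; apply: eq_bigr => S _.
  by case: (i \in S); case: (j \in S); rewrite /= ?addr0 ?add0r.
by rewrite (Ni true true) (Ni true false) /= (Nj false false) /= => <-; ring.
Qed.

(** After exchanging the sums, each pair of distinct indices is counted by a quarter of the subsets,
    and a diagonal pair by none. *)
Lemma decoupling (a : I -> I -> R) :
  4 * \sum_(S : {set I}) \sum_(i | i \notin S) \sum_(j in S) a i j =
  #|{set I}|%:R * \sum_i \sum_(j | j != i) a i j.
Proof.
have -> : \sum_(S : {set I}) \sum_(i | i \notin S) \sum_(j in S) a i j =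
    \sum_i \sum_j a i j * \sum_(S : {set I}) ((i \notin S) && (j \in S))%:R.
  transitivity (\sum_(S : {set I}) \sum_i \sum_j a i j * ((i \notin S) && (j \in S))%:R).
    apply: eq_bigr => S _; rewrite big_mkcond; apply: eq_bigr => i _.
    case: ifPn => iS; last by rewrite big1// => j _; rewrite mulr0.
    rewrite big_mkcond; apply: eq_bigr => j _.
    by case: ifPn; rewrite ?mulr1 ?mulr0.
  rewrite exchange_big; apply: eq_bigr => i _.
  by rewrite exchange_big; apply: eq_bigr => j _; rewrite mulr_sumr.
rewrite !mulr_sumr; apply: eq_bigr => i _.
rewrite !mulr_sumr [RHS]big_mkcond; apply: eq_bigr => j _.
rewrite mulrCA; case: eqVneq => [->|ji].
  by rewrite big1 ?mulr0// => S _; rewrite andNb.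
by rewrite sum_separating_sets 1?eq_sym// mulrC.
Qed.

(** Jensen's inequality for the uniform average: in the tangent bound of the exponential at the mean
    [m], the linear terms sum to zero. *)
Lemma expR_average (J : finType) (y : J -> R) : (0 < #|J|)%N ->
  #|J|%:R * expR (#|J|%:R^-1 * \sum_k y k) <= \sum_k expR (y k).
Proof.
move=> J0; set N : R := #|J|%:R; set m := N^-1 * _.
have N0 : N != 0 by rewrite pnatr_eq0 -lt0n.
have -> : N * expR m = \sum_k expR m * (1 + (y k - m)).
  rewrite -mulr_sumr big_split sumrB /= !sumr_const -/N mulrC.
  have -> : \sum_k y k = N * m by rewrite mulrA divff// mul1r.
  by rewrite -mulr_natl -/N; congr (_ * _); ring.
apply: ler_sum => k _; apply: le_trans (_ : expR m * expR (y k - m) <= _).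
  by rewrite ler_pM2l ?expR_gt0// expR_ge1Dx.
by rewrite -expRD addrC subrK.
Qed.

End decoupling.

(** * Diagonal and off-diagonal exponential moments *)

Section quadratic_mgf.
Local Open Scope ereal_scope.
Context {d} {T : measurableType d} {R : realType} {P : probability T R}.
Context {I : finType} {X : I -> {RV P >-> R}} (indX : mutually_independent X).

Lemma measurable_sum_cond (Q : pred I) (h : I -> T -> R) :
  (forall i, measurable_fun setT (h i)) ->
  measurable_fun setT (fun w => \sum_(i | Q i) h i w)%R.
Proof.
move=> mh; under eq_fun do rewrite big_mkcond.
by apply: measurable_sum => i; case: (Q i).
Qed.

(** Conditional bounds are applied to the indices of [r] one at a time. The parameters [G i] involve
    no variable indexed by [r]; [H] is general because it accumulates the factors [phi] already
    obtained. *)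
Lemma le_integrate_seq (f : I -> R -> R -> R) (phi : I -> R -> R)
    (G : I -> T -> R) (r : seq I) (H : T -> R) :
  uniq r ->
  (forall i, measurable_fun setT (fun z : R * R => f i z.1 z.2)) ->
  (forall i x g, 0 <= f i x g)%R ->
  (forall i, measurable_fun setT (phi i)) -> (forall i g, 0 <= phi i g)%R ->
  (forall i g, \int[P]_w (f i (X i w) g)%:E <= (phi i g)%:E) ->
  (forall i j, i \in r -> j \in r ->
     measurable_fun setT (G i : off_type X j -> R)) ->
  (forall j, j \in r -> measurable_fun setT (H : off_type X j -> R)) ->
  (forall w, 0 <= H w)%R ->
  \int[P]_w (H w * \prod_(i <- r) f i (X i w) (G i w))%:E <=
  \int[P]_w (H w * \prod_(i <- r) phi i (G i w))%:E.
Proof.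
move=> + mf f0 mphi phi0 fphi; elim: r H => [|j r IH] H /=.
  by move=> _ _ _ _; under eq_integral do rewrite big_nil;
     under [leRHS]eq_integral do rewrite big_nil.
move=> /andP[jr ur] mG mH H0.
(* The other factors do not involve [X j], as [j] does not occur in [r]; they are frozen together
   with [H]. *)
pose H' w := (H w * \prod_(i <- r) f i (X i w) (G i w))%R.
apply: (@le_trans _ _ (\int[P]_w (H' w * f j (X j w) (G j w))%:E)).
  rewrite le_eqVlt; apply/orP; left; apply/eqP.
  by apply: eq_integral => w _; rewrite big_cons /H'; congr EFin; ring.
have jjr : j \in j :: r by rewrite inE eqxx.
have in_jr i : i \in r -> i \in j :: r by rewrite inE => ->; rewrite orbT.
apply: le_trans (le_integrate_out indX j (f j) (phi j) (G j) H' _ _ _ _ _ _ _ _) _ => //.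
- exact: mG.
- apply: measurable_funM; first exact: mH.
  apply: measurable_prod => i ir.
  apply: (measurableT_comp (f := fun z : R * R => f i z.1 z.2)
    (g := fun w : off_type X j => (X i w, G i w))) => //.
  apply/measurable_fun_pair; last by apply: mG => //; exact: in_jr.
  by apply: measurable_off; apply: contraNneq jr => <-.
- by move=> w; rewrite mulr_ge0// prodr_ge0.
(* The new factor is free of the variables indexed by [r] and joins [H] for the induction
   hypothesis. *)
apply: (@le_trans _ _ (\int[P]_w ((H w * phi j (G j w)) *
    \prod_(i <- r) f i (X i w) (G i w))%:E)).
  rewrite le_eqVlt; apply/orP; left; apply/eqP.
  by apply: eq_integral => w _; rewrite /H'; congr EFin; ring.
apply: le_trans (IH _ ur _ _ _) _.
- by move=> i k ir kr; apply: mG; exact: in_jr.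
- move=> k kr; apply: measurable_funM; first by apply: mH; exact: in_jr.
  by apply: (measurableT_comp (mphi j)); apply: mG => //; exact: in_jr.
- by move=> w; rewrite mulr_ge0.
rewrite le_eqVlt; apply/orP; left; apply/eqP.
by apply: eq_integral => w _; rewrite big_cons; congr EFin; ring.
Qed.

Lemma integral_prod_le (f : I -> R -> R) (c : I -> R) :
  (forall i, measurable_fun setT (f i)) -> (forall i x, 0 <= f i x)%R ->
  (forall i, 0 <= c i)%R ->
  (forall i, \int[P]_w (f i (X i w))%:E <= (c i)%:E) ->
  \int[P]_w (\prod_i f i (X i w))%:E <= (\prod_i c i)%:E.
Proof.
move=> mf f0 c0 fc.
rewrite -[leRHS](@integral_probability_cst _ _ _ P) -[(\prod_i c i)%R]mul1r.
under eq_integral do rewrite -[(\prod_i _)%R]mul1r.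
apply: (le_integrate_seq (fun i x _ => f i x) (fun i _ => c i) (fun _ _ => 0%R)
  (index_enum I) (fun=> 1%R) (index_enum_uniq I)) => // i.
exact: measurableT_comp.
Qed.

Context {v : R} (v0 : (0 < v)%R).
Hypothesis expX : forall i, \int[P]_w (expR ((X i w / v) ^+ 2))%:E <= 2%:E.

Lemma mgf_sqr_sum_le (mu : R) : (0 <= mu <= 1)%R ->
  \int[P]_w (expR (mu * \sum_i (X i w / v) ^+ 2))%:E <= (expR (mu *+ #|I|))%:E.
Proof.
move=> mu01.
under eq_integral do rewrite mulr_sumr expR_sum.
rewrite -sumr_const expR_sum.
apply: (integral_prod_le (fun i x => expR (mu * (x / v) ^+ 2))) => i //.
- apply: measurableT_comp => //; apply: measurable_funM => //.
  by apply: measurable_funX; exact: measurable_funM.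
- exact: mgf_sqr_le (expX i) _ mu01.
Qed.

(** The exponential factors over the indices, and each factor is a centered square moment with
    parameter [lam * m i * v ^+ 2], at most 1/2 in absolute value. *)
Lemma mgf_diagonal_le (s lam : R) (m : I -> R) (M : R) :
  (forall i, \int[P]_w ((X i w / v) ^+ 2)%:E = s%:E) ->
  (forall i, `|m i| <= M)%R -> (`|lam| * M * v ^+ 2 <= 2^-1)%R ->
  \int[P]_w (expR (lam * \sum_i m i * (X i w ^+ 2 - s * v ^+ 2)))%:E <=
  (expR ((64 * (lam * M * v ^+ 2) ^+ 2) *+ #|I|))%:E.
Proof.
move=> Es mM lamM.
have tau_le i : (`|lam * m i * v ^+ 2| <= `|lam| * M * v ^+ 2)%R.
  by rewrite 2!normrM (ger0_norm (sqr_ge0 v)) ler_wpM2r ?sqr_ge0//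
     ler_wpM2l.
apply: le_trans (_ : _ <= (expR (\sum_i 64 * (lam * m i * v ^+ 2) ^+ 2))%:E) _.
- under eq_integral => w _.
    rewrite (_ : (lam * \sum_i m i * (X i w ^+ 2 - s * v ^+ 2) =
      \sum_i lam * m i * v ^+ 2 * ((X i w / v) ^+ 2 - s))%R); last first.
      by rewrite mulr_sumr; apply: eq_bigr => i _; field; rewrite gt_eqF.
    rewrite expR_sum; over.
  rewrite expR_sum; apply: (integral_prod_le
    (fun i x => expR (lam * m i * v ^+ 2 * ((x / v) ^+ 2 - s)))) => i //.
  + apply: measurableT_comp => //; apply: measurable_funM => //.
    apply: measurable_funB => //.
    by apply: measurable_funX; exact: measurable_funM.
  + by apply: (mgf_sqr_centered_le (expX i)) => //; exact: le_trans (tau_le i) lamM.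
- rewrite lee_fin ler_expR -sumr_const; apply: ler_sum => i _.
  rewrite ler_pM2l// -[leLHS]real_normK ?num_real//.
  rewrite -[leRHS]real_normK ?num_real// ler_sqr ?nnegrE ?normr_ge0//.
  apply: le_trans (tau_le i) _.
  by rewrite 2!normrM (ger0_norm (sqr_ge0 v)) ler_wpM2r ?sqr_ge0//
    ler_wpM2l// ler_norm.
Qed.

Hypothesis EX : forall i, \int[P]_w (X i w)%:E = 0.
Context {b : I -> I -> R} {beta : R}.
Hypothesis b_beta : forall x : I -> R,
  (\sum_i (\sum_j b i j * x j) ^+ 2 <= beta ^+ 2 * \sum_j x j ^+ 2)%R.

(** Given the variables in [S], the sum is linear in those outside, with coefficients [lam * G i].
    Integrating the latter out leaves [2 lam^2 v^2 \sum_i (G i)^2] in the exponent, which [b_beta]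
    reduces to a sum of independent squares. *)
Lemma mgf_decoupled_le (S : {set I}) (lam : R) :
  (2 * (lam * beta * v ^+ 2) ^+ 2 <= 1)%R ->
  \int[P]_w (expR (lam *
     \sum_(i | i \notin S) \sum_(j in S) X i w * b i j * X j w))%:E <=
  (expR ((2 * (lam * beta * v ^+ 2) ^+ 2) *+ #|I|))%:E.
Proof.
move=> small; set mu := (2 * _)%R in small *.
have mu01 : (0 <= mu <= 1)%R by rewrite small andbT mulr_ge0 ?sqr_ge0.
(* Extension by zero outside [S] lets [b_beta] apply to a vector indexed by all of [I]. *)
pose Y j : T -> R := if j \in S then (X j : T -> R) else fun=> 0%R.
pose G i (w : T) : R := (\sum_j b i j * Y j w)%R.
have mG i j : j \in enum (~: S)%SET -> measurable_fun setT (G i : off_type X j -> R).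
  rewrite mem_enum inE => jS; apply: measurable_sum => k.
  apply: measurable_funM => //; rewrite /Y; case: ifPn => // kS.
  by apply: measurable_off; apply: contraNneq jS => <-.
have mGT i : measurable_fun setT (G i).
  apply: measurable_sum => k; apply: measurable_funM => //.
  by rewrite /Y; case: ifPn.
have eqL w : (\sum_(i <- enum (~: S)%SET) lam * G i w * X i w =
    lam * \sum_(i | i \notin S) \sum_(j in S) X i w * b i j * X j w)%R.
  rewrite big_enum mulr_sumr; apply: eq_big => [i|i _]; first by rewrite inE.
  rewrite -mulrA; congr (_ * _)%R; rewrite mulr_suml [RHS]big_mkcond.
  apply: eq_bigr => j _; rewrite /Y; case: ifPn => _; last by rewrite mulr0 mul0r.
  by ring.
under eq_integral do rewrite -eqL expR_sum -[(\prod_(_ <- _) _)%R]mul1r.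
apply: le_trans (le_integrate_seq (fun i x g => expR ((lam * g) * x))
  (fun i g => expR (2 * (lam * g) ^+ 2 * v ^+ 2)) G (enum (~: S)%SET)
  (fun=> 1%R) (enum_uniq _) _ _ _ _ _ _ _ _) _ => //.
- move=> i; apply: measurableT_comp => //; apply: measurable_funM => //.
  by apply: measurable_funM => //.
- move=> i; apply: measurableT_comp => //; apply: measurable_funM => //.
  apply: measurable_funM => //; apply: measurable_funX; exact: measurable_funM.
- by move=> i g; apply: (mgf_le v0 (expX i)).
- by move=> i j _; exact: mG.
apply: le_trans (mgf_sqr_sum_le _ mu01); apply: ge0_le_integral => //.
- by move=> w _; rewrite lee_fin mul1r prodr_ge0// => i _; exact: expR_ge0.
- apply/measurable_EFinP; apply: measurable_funM => //.
  apply: measurable_prod => i _; apply: measurableT_comp => //.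
  apply: measurable_funM => //; apply: measurable_funM => //.
  by apply: measurable_funX; exact: measurable_funM.
- apply/measurable_EFinP; apply: measurableT_comp => //; apply: measurable_funM => //.
  by apply: measurable_sum => i; apply: measurable_funX; exact: measurable_funM.
move=> w _; rewrite mul1r -expR_sum lee_fin ler_expR.
have c0 : (0 <= 2 * lam ^+ 2 * v ^+ 2)%R.
  by rewrite -mulrA -exprMn mulr_ge0 ?sqr_ge0.
apply: (@le_trans _ _ (2 * lam ^+ 2 * v ^+ 2 * \sum_i G i w ^+ 2)%R).
  rewrite big_enum [leLHS]big_mkcond mulr_sumr; apply: ler_sum => i _ /=.
  case: ifPn => _; last by rewrite mulr_ge0 ?sqr_ge0.
  by rewrite le_eqVlt; apply/orP; left; apply/eqP; ring.
apply: le_trans (ler_wpM2l c0 (b_beta (Y^~ w))) _.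
rewrite mulrA (_ : (\sum_i (X i w / v) ^+ 2 = v ^- 2 * \sum_i X i w ^+ 2)%R); last first.
  by rewrite mulr_sumr; apply: eq_bigr => i _; rewrite exprMn exprVn mulrC.
rewrite [leRHS]mulrA (_ : (mu * v ^- 2 = 2 * lam ^+ 2 * v ^+ 2 * beta ^+ 2)%R); last first.
  by rewrite /mu; field; rewrite gt_eqF.
apply: ler_wpM2l; first by rewrite mulr_ge0 ?sqr_ge0.
apply: ler_sum => i _; rewrite /Y; case: ifPn => // _.
by rewrite expr0n sqr_ge0.
Qed.

(** Decoupling and Jensen's inequality replace [lam] by [4 * lam] at each fixed subset, so the
    constant 2 of [mgf_decoupled_le] becomes 32. *)
Lemma mgf_off_diagonal_le (lam : R) :
  (32 * (lam * beta * v ^+ 2) ^+ 2 <= 1)%R ->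
  \int[P]_w (expR (lam * \sum_i \sum_(j | j != i) X i w * b i j * X j w))%:E <=
  (expR ((32 * (lam * beta * v ^+ 2) ^+ 2) *+ #|I|))%:E.
Proof.
move=> small.
have e32 : (32 * (lam * beta * v ^+ 2) ^+ 2 =
    2 * (4 * lam * beta * v ^+ 2) ^+ 2)%R by ring.
pose D (S : {set I}) w :=
  (\sum_(i | i \notin S) \sum_(j in S) X i w * b i j * X j w)%R.
have mD S : measurable_fun setT (fun w => expR (4 * lam * D S w)).
  apply: measurableT_comp => //; apply: measurable_funM => //.
  apply: measurable_sum_cond => i; apply: measurable_sum_cond => j.
  by apply: measurable_funM => //; exact: measurable_funM.
set N : R := #|{set I}|%:R.
have N0 : (0 < N)%R by rewrite ltr0n; apply/card_gt0P; exists finset.set0.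
apply: (@le_trans _ _ (\int[P]_w (N^-1 * \sum_(S : {set I}) expR (4 * lam * D S w))%:E)).
  apply: ge0_le_integral => //.
  - apply/measurable_EFinP; apply: measurableT_comp => //; apply: measurable_funM => //.
    apply: measurable_sum => i; apply: measurable_sum_cond => j.
    by apply: measurable_funM => //; exact: measurable_funM.
  - apply/measurable_EFinP; apply: measurable_funM => //.
    exact: measurable_sum.
  move=> w _; rewrite lee_fin ler_pdivlMl//.
  have avg := expR_average _ (fun S : {set I} => 4 * lam * D S w)%R.
  apply: le_trans (avg _); last by apply/card_gt0P; exists finset.set0.
  rewrite ler_pM2l// ler_expR -mulr_sumr -/N.
  have := decoupling (fun i j => X i w * b i j * X j w)%R; rewrite -/N => E.
  rewrite (_ : N^-1 * _ = lam * (N^-1 * (4 * \sum_(S : {set I}) D S w)))%R; last first.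
    by ring.
  by rewrite E mulKf// gt_eqF.
under eq_integral do rewrite EFinM -sumEFin.
rewrite ge0_integralZl_EFin ?invr_ge0 ?(ltW N0)//; last 2 first.
- by move=> w _; apply: sume_ge0 => S _; rewrite lee_fin expR_ge0.
- by apply: emeasurable_sum => S; exact/measurable_EFinP.
rewrite ge0_integral_sum//; last by move=> S; exact/measurable_EFinP.
rewrite e32 in small *.
set B := expR _.
apply: (@le_trans _ _ (N^-1%:E * \sum_(S : {set I}) B%:E)).
  rewrite lee_wpmul2l ?lee_fin ?invr_ge0 ?(ltW N0)//.
  by apply: lee_sum => S _; exact: mgf_decoupled_le.
rewrite sumEFin -EFinM lee_fin sumr_const -[(B *+ _)%R]mulr_natl -/N.
by rewrite mulKf// gt_eqF.
Qed.

End quadratic_mgf.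

(** * Chernoff bound for a quadratic form of negative trace *)

Section quadratic_tail.
Local Open Scope ereal_scope.
Context {d} {T : measurableType d} {R : realType} {P : probability T R}.

Lemma measurable_set_ge (Y : T -> R) (a : R) :
  measurable_fun setT Y -> measurable [set w | (a <= Y w)%R].
Proof.
move=> mY; rewrite (_ : [set w | _] = setT `&` Y @^-1` `[a, +oo[).
  exact: mY.
by apply/seteqP; split=> w /=; rewrite in_itv /= andbT// => -[].
Qed.

(** Markov's inequality: the indicator of the event is at most [expR (Y w - a)]. *)
Lemma chernoff_le (Y : T -> R) (a c : R) : measurable_fun setT Y ->
  \int[P]_w (expR (Y w))%:E <= (expR c)%:E ->
  P [set w | (a <= Y w)%R] <= (expR (c - a))%:E.
Proof.
move=> mY Yc; have mA := measurable_set_ge Y a mY.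
have -> : P [set w | (a <= Y w)%R] = \int[P]_w (\1_[set w | (a <= Y w)%R] w)%:E.
  by rewrite integral_indic// setIT.
apply: (@le_trans _ _ (\int[P]_w ((expR (- a))%:E * (expR (Y w))%:E))).
  apply: ge0_le_integral => //.
  - by apply/measurable_EFinP.
  - apply: measurable_funeM; apply/measurable_EFinP.
    exact: measurableT_comp.
  - move=> w _; rewrite -EFinM lee_fin -expRD indicE.
    case: (boolP (w \in _)) => [|_]; last exact: expR_ge0.
    rewrite inE /= => aY; apply: le_trans (expR_ge1Dx _).
    by rewrite lerDl addrC subr_ge0.
rewrite ge0_integralZl_EFin ?expR_ge0//; last first.
  by apply/measurable_EFinP; exact: measurableT_comp.
rewrite addrC expRD EFinM lee_wpmul2l// lee_fin; exact: expR_ge0.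
Qed.

Context {I : finType} {X : I -> {RV P >-> R}} (indX : mutually_independent X).
Context {v s : R} (v0 : (0 < v)%R).
Hypothesis expX : forall i, \int[P]_w (expR ((X i w / v) ^+ 2))%:E <= 2%:E.
Hypothesis EX : forall i, \int[P]_w (X i w)%:E = 0.
Hypothesis VX : forall i, \int[P]_w ((X i w / v) ^+ 2)%:E = s%:E.
Context {b : I -> I -> R} {m : I -> R} {beta : R} (beta0 : (0 < beta)%R).
Hypothesis b_beta : forall x : I -> R,
  (\sum_i (\sum_j b i j * x j) ^+ 2 <= beta ^+ 2 * \sum_j x j ^+ 2)%R.
Hypothesis m_beta : forall i, (`|m i| <= 4 * beta)%R.

Let off w := (\sum_i \sum_(j | j != i) X i w * b i j * X j w)%R.

Let m_off : measurable_fun setT off.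
Proof.
apply: measurable_sum => i; apply: measurable_sum_cond => j.
by apply: measurable_funM => //; exact: measurable_funM.
Qed.

Let diag w := (\sum_i m i * (X i w ^+ 2 - s * v ^+ 2))%R.

Let m_diag : measurable_fun setT diag.
Proof.
apply: measurable_sum => i; apply: measurable_funM => //.
by apply: measurable_funB => //; exact: measurable_funX.
Qed.

(** The two dependent parts are separated by [expR ((x + y) / 2) <= (expR x + expR y) / 2], at the
    cost of doubling [lam]. The diagonal part, with entries up to [4 * beta], then has parameter at
    most [8 u], whence the threshold 1/16 and the constant [64 * 8^2 = 64^2]. *)
Lemma mgf_quadratic_le (lam : R) : (0 <= lam)%R ->
  (lam * beta * v ^+ 2 <= 16^-1)%R ->
  \int[P]_w (expR (lam * (off w + diag w)))%:E <=
  (expR ((64 * (lam * beta * v ^+ 2)) ^+ 2 *+ #|I|))%:E.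
Proof.
move=> lam0; set u := (lam * beta * v ^+ 2)%R => u_le.
have u0 : (0 <= u)%R by rewrite /u !mulr_ge0 ?sqr_ge0// ltW.
have mexp (Y : T -> R) c : measurable_fun setT Y ->
    measurable_fun setT (fun w => (expR (c * Y w))%:E).
  move=> mY; apply/measurable_EFinP/measurableT_comp => //.
  exact: measurable_funM.
have le_off : \int[P]_w (expR (2 * lam * off w))%:E <=
    (expR ((64 * u) ^+ 2 *+ #|I|))%:E.
  have := mgf_off_diagonal_le indX v0 expX EX b_beta (2 * lam)%R.
  have -> : (32 * (2 * lam * beta * v ^+ 2) ^+ 2 = 128 * u ^+ 2)%R.
    by rewrite /u; ring.
  move=> H; apply: le_trans (H _) _; first by nra.
  by rewrite lee_fin ler_expR ler_wMn2r//; have := sqr_ge0 u; nra.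
have le_diag : \int[P]_w (expR (2 * lam * diag w))%:E <=
    (expR ((64 * u) ^+ 2 *+ #|I|))%:E.
  have := mgf_diagonal_le indX v0 expX s (2 * lam)%R m (4 * beta)%R VX m_beta.
  have -> : (64 * (2 * lam * (4 * beta) * v ^+ 2) ^+ 2 = (64 * u) ^+ 2)%R.
    by rewrite /u; ring.
  apply; rewrite ger0_norm ?mulr_ge0//.
  rewrite (_ : 2 * lam * (4 * beta) * v ^+ 2 = 8 * u)%R; last by rewrite /u; ring.
  by lra.
have half0 : (0 <= 2^-1 :> R)%R by rewrite invr_ge0.
apply: (@le_trans _ _ (\int[P]_w ((2^-1)%:E *
    ((expR (2 * lam * off w))%:E + (expR (2 * lam * diag w))%:E)))).
  apply: ge0_le_integral => //.
  - by apply: mexp; exact: measurable_funD.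
  - apply: measurable_funeM; apply: emeasurable_funD; exact: mexp.
  - move=> w _; rewrite -EFinD -EFinM lee_fin.
    rewrite (_ : lam * (off w + diag w) =
      2^-1 * (2 * lam * off w) + 2^-1 * (2 * lam * diag w))%R; last by field.
    rewrite expRD.
    set x := (2 * lam * off w)%R; set y := (2 * lam * diag w)%R.
    have sq (z : R) : expR z = (expR (2^-1 * z) ^+ 2)%R.
      by rewrite -expRM_natl; congr expR; field.
    rewrite [in leRHS](sq x) [in leRHS](sq y).
    by have := sqr_ge0 (expR (2^-1 * x) - expR (2^-1 * y)); nra.
rewrite ge0_integralZl_EFin//; last 2 first.
- by move=> w _; rewrite adde_ge0// lee_fin expR_ge0.
- by apply: emeasurable_funD; exact: mexp.
rewrite ge0_integralD//; last 2 first.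
- exact: mexp.
- exact: mexp.
move: (expR _) le_off le_diag => B le_off le_diag.
apply: le_trans (lee_wpmul2l _ (leeD le_off le_diag)) _; first by rewrite lee_fin.
by rewrite -EFinD -EFinM lee_fin; lra.
Qed.

(** Centering the squares adds [s v^2 tau] per index, by the value of the trace. The event thus
    forces [off + diag] to exceed a level linear in [#|I|], and Chernoff's bound applies. *)
Lemma quadratic_tail (tau : R) : (0 <= tau <= 2 * beta)%R -> (0 <= s <= 1)%R ->
  (\sum_i m i = - (tau *+ #|I|))%R ->
  P [set w | (0 <= off w + \sum_i m i * X i w ^+ 2)%R] <=
  (expR (- ((s * tau / (128 * beta)) ^+ 2 *+ #|I|)))%:E.
Proof.
move=> /andP[tau0 tau_le] /andP[s0 s1] tr.
(* this choice minimizes the Chernoff exponent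
   (64 lam beta v^2)^2 - lam s v^2 tau (per index) *)
pose lam : R := (s * tau / (2 * 64 ^+ 2 * beta ^+ 2 * v ^+ 2))%R.
have v2 : (0 < v ^+ 2)%R by exact: exprn_gt0.
have lam0 : (0 <= lam)%R.
  apply: divr_ge0; first exact: mulr_ge0.
  apply: mulr_ge0 (ltW v2); apply: mulr_ge0 (sqr_ge0 _).
  exact: mulr_ge0 (ler0n _ _) (sqr_ge0 _).
have uE : (lam * beta * v ^+ 2 = s * tau / beta / (2 * 64 ^+ 2))%R.
  by rewrite /lam; field; rewrite !gt_eqF.
have stau : (s * tau / beta <= 2)%R.
  by rewrite ler_pdivrMr//; nra.
have u_le : (lam * beta * v ^+ 2 <= 16^-1)%R by rewrite uE; lra.
have mY : measurable_fun setT (fun w => lam * (off w + diag w))%R.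
  by apply: measurable_funM => //; exact: measurable_funD.
have := chernoff_le _ (lam * s * v ^+ 2 * tau *+ #|I|)%R _ mY
  (mgf_quadratic_le _ lam0 u_le).
rewrite uE -mulrnBl (_ : (_ - _ = - ((s * tau / (128 * beta)) ^+ 2))%R); last first.
  by rewrite /lam; field; rewrite !gt_eqF.
rewrite mulNrn; apply: le_trans; apply: le_measure; rewrite ?inE.
- apply: measurable_set_ge; apply: measurable_funD => //; apply: measurable_sum => i.
  by apply: measurable_funM => //; exact: measurable_funX.
- exact: measurable_set_ge.
move=> w /= q0.
have -> : (off w + diag w =
    off w + \sum_i m i * X i w ^+ 2 + s * v ^+ 2 * (tau *+ #|I|))%R.
  rewrite -addrA; congr (_ + _)%R.
  rewrite -[(tau *+ _)%R]opprK -tr mulrN mulr_sumr -sumrB.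
  by apply: eq_bigr => i _; ring.
rewrite [leRHS]mulrDr -mulr_natr -[(tau *+ _)%R]mulr_natr.
by have := mulr_ge0 lam0 q0; nra.
Qed.

End quadratic_tail.

(** * Replacing the center by the mean *)

Section recentering.
Local Open Scope ereal_scope.
Context {d} {T : measurableType d} {R : realType} {P : probability T R}.

(** A discrete layer-cake bound: the layers start at [k = 0], so the last, partly filled one is
    counted in full. *)
Lemma min_le_sum_indic (z delta : R) (N : nat) : (0 <= z)%R -> (0 <= delta)%R ->
  (Num.min z (N%:R * delta) <= \sum_(k < N) delta * (k%:R * delta <= z)%R%:R)%R.
Proof.
move=> z0 delta0; elim: N => [|N IH].
  by rewrite mul0r big_ord0 ge_min lexx orbT.
rewrite big_ord_recr /=; have [le_z|lt_z] := leP (N%:R * delta)%R z.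
  rewrite mulr1; apply: le_trans (_ : N%:R * delta + delta <= _)%R.
    by rewrite ge_min -natr1 mulrDl mul1r lexx orbT.
  by rewrite lerD2r; move: IH; rewrite min_r.
rewrite mulr0 addr0; apply: le_trans IH.
by rewrite [leRHS]min_l ?ge_min ?lexx// ltW.
Qed.

(** Boundedness makes finitely many layers of height [delta] suffice, and the geometric sum of their
    probabilities is bounded uniformly in their number. *)
Lemma integral_geometric_tail_le (Z : T -> R) (B delta r : R) :
  measurable_fun setT Z -> (forall w, 0 <= Z w <= B)%R ->
  (0 < delta)%R -> (0 <= r < 1)%R ->
  (forall k : nat, P [set w | (k%:R * delta <= Z w)%R] <= (2 * r ^+ k)%:E) ->
  \int[P]_w (Z w)%:E <= (2 * delta / (1 - r))%:E.
Proof.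
move=> mZ ZB delta0 /andP[r0 r1] tail.
have [N BN] : exists N : nat, (B <= N%:R * delta)%R.
  exists (Num.trunc (B / delta)).+1.
  by rewrite -ler_pdivrMr// ltW// truncnS_gt.
pose A (k : nat) := [set w | (k%:R * delta <= Z w)%R].
have mA k : measurable (A k) by exact: measurable_set_ge.
have mI (k : nat) : measurable_fun setT (fun w => (delta * \1_(A k) w)%:E).
  by apply/measurable_EFinP; apply: measurable_funM.
apply: (@le_trans _ _ (\int[P]_w (\sum_(k < N) (delta * \1_(A k) w)%:E))).
  apply: ge0_le_integral => //.
  - by move=> w _; rewrite lee_fin; case/andP: (ZB w).
  - exact/measurable_EFinP.
  - by apply: emeasurable_sum => k; exact: mI.
  move=> w _; have /andP[Z0 ZB1] := ZB w.
  rewrite sumEFin lee_fin.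
  have := min_le_sum_indic (Z w) delta N Z0 (ltW delta0).
  rewrite min_l; last exact: le_trans BN.
  move=> /le_trans; apply; apply: ler_sum => k _.
  rewrite indicE (_ : (w \in A k) = (k%:R * delta <= Z w)%R)//.
  by apply/idP/idP; rewrite inE.
rewrite ge0_integral_sum//; last by move=> k w _; rewrite lee_fin mulr_ge0// ltW.
apply: (@le_trans _ _ (\sum_(k < N) (delta * (2 * r ^+ k))%:E)).
  apply: lee_sum => k _; under eq_integral do rewrite EFinM.
  rewrite ge0_integralZl_EFin ?(ltW delta0)//; last first.
    exact/measurable_EFinP.
  rewrite integral_indic// setIT EFinM lee_wpmul2l// ?lee_fin ?(ltW delta0)//.
  exact: tail.
rewrite sumEFin lee_fin -!mulr_sumr [leLHS]mulrCA -mulrA ler_pM2l// ler_pM2l//.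
have r1' : (0 < 1 - r)%R by rewrite subr_gt0.
rewrite -[leRHS]mul1r ler_pdivlMr// mulrC.
have := subrX1 r N; have := exprn_ge0 N r0; lra.
Qed.

(** The tail around [a] places the mean within [D * delta] of [a]. If [t] exceeds twice this shift,
    a deviation [t] from the mean is a deviation of at least [t / 2] from [a], whence [c / 4]. *)
Lemma recentering (Q : T -> R) (a B delta c : R) :
  measurable_fun setT Q -> (forall w, `|Q w| <= B)%R ->
  (0 < delta)%R -> (0 < c)%R ->
  (forall tau, (0 <= tau)%R ->
    P [set w | (tau <= `|Q w - a|)%R] <= (2 * expR (- (c * (tau / delta) ^+ 2)))%:E) ->
  forall t, (0 < t)%R ->
  P [set w | t%:E <= `|(Q w)%:E - 'E_P[Q]|] <=
  ((2 + expR (c * (2 / (1 - expR (- c))) ^+ 2)) *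
   expR (- (c / 4 * (t / delta) ^+ 2)))%:E.
Proof.
move=> mQ QB delta0 c0 tail t t0.
set D : R := (2 / (1 - expR (- c)))%R.
have iQ : P.-integrable setT (EFin \o Q).
  apply: (@le_integrable _ _ _ _ _ _ _ (EFin \o cst B)) => //.
  - exact/measurable_EFinP.
  - by move=> w _ /=; rewrite lee_fin (le_trans (QB w))// ler_norm.
  - exact: finite_measure_integrable_cst.
have ia : P.-integrable setT (EFin \o cst a).
  exact: finite_measure_integrable_cst.
have [e EQ] : exists e : R, 'E_P[Q] = e%:E.
  exists (fine 'E_P[Q]); rewrite fineK// unlock.
  exact: integrable_fin_num.
have mQa : measurable_fun setT (fun w => `|Q w - a|%R).
  by apply: measurableT_comp => //; exact: measurable_funB.
have c1 : (expR (- c) < 1)%R by rewrite expR_lt1 oppr_lt0.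
have ea : (`|e - a| <= D * delta)%R.
  have -> : (D * delta = 2 * delta / (1 - expR (- c)))%R by rewrite /D mulrAC.
  rewrite -lee_fin.
  apply: le_trans (integral_geometric_tail_le (fun w => `|Q w - a|%R)
    (B + `|a|) delta (expR (- c)) mQa _ delta0 _ _).
  - have -> : `|(e - a)|%R%:E = `|\int[P]_w (Q w - a)%:E|.
      under eq_integral do rewrite EFinB.
      rewrite (integralB_EFin measurableT iQ ia).
      move: EQ; rewrite unlock => ->.
      by rewrite /= integral_probability_cst.
    apply: le_trans (le_abse_integral _ measurableT _) _ => //.
    by apply/measurable_EFinP; exact: measurable_funB.
  - by move=> w; rewrite normr_ge0 (le_trans (ler_normB _ _))// lerD2r.
  - by rewrite expR_ge0.
  (* Since [k <= k ^+ 2], the Gaussian tail at [k * delta] is below a geometric one of ratio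
     [expR (- c)]. *)
  - move=> k; apply: le_trans (tail _ _) _; first by rewrite mulr_ge0// ltW.
    rewrite lee_fin ler_pM2l// mulfK ?gt_eqF// -expRM_natl ler_expR.
    rewrite mulrN lerN2 mulrC ler_pM2l//.
    case: k => [|k]; first by rewrite expr0n.
    by rewrite -[leLHS]mulr1 expr2 ler_pM2l ?ltr0n// ler1n.
have mset : measurable [set w | t%:E <= `|(Q w)%:E - 'E_P[Q]|].
  rewrite EQ (_ : [set w | _] = [set w | (t <= `|Q w - e|)%R]).
    apply: measurable_set_ge.
    by apply: measurableT_comp => //; exact: measurable_funB.
  by apply/seteqP; split => w /=; rewrite lee_fin.
have D0 : (0 <= D)%R by rewrite /D divr_ge0// subr_ge0 ltW.
(* Up to twice the shift the claimed bound is at least 1, thanks to the summand [expR (c * D ^+ 2)]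
   of the constant. *)
have [t_le|t_gt] := leP t (2 * (D * delta))%R.
  apply: le_trans (probability_le1 _ mset) _; rewrite lee_fin.
  have h : (1 <= expR (c * D ^+ 2) * expR (- (c / 4 * (t / delta) ^+ 2)))%R.
    rewrite -expRD; apply: le_trans (expR_ge1Dx _); rewrite lerDl subr_ge0.
    rewrite -mulrA ler_pM2l//.
    have : (t / delta <= 2 * D)%R by rewrite ler_pdivrMr// -mulrA.
    have : (0 <= t / delta)%R by rewrite divr_ge0// ltW.
    by nra.
  rewrite mulrDl; apply: le_trans h _.
  by rewrite lerDr mulr_ge0// expR_ge0.
apply: (@le_trans _ _ (P [set w | (t / 2 <= `|Q w - a|)%R])).
  apply: le_measure; rewrite ?inE//; first exact: measurable_set_ge.
  move=> w; rewrite EQ /= lee_fin => te.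
  have := ler_distD a (Q w) e; rewrite [(`|a - e|)%R]distrC; lra.
apply: le_trans (tail _ _) _; first by rewrite divr_ge0// ltW.
rewrite lee_fin (_ : (c * (t / 2 / delta) ^+ 2 = c / 4 * (t / delta) ^+ 2)%R); last first.
  by field; rewrite gt_eqF.
by rewrite ler_pM2r ?expR_gt0// lerDl expR_ge0.
Qed.

End recentering.

(** * Spectral norm and sub-Gaussian norm *)

Section spectral_norm.
Context {R : realType} {n : nat}.
Implicit Types (A : 'M[R]_n) (v : 'cV[R]_n).

Lemma l2norm_ge0 v : 0 <= l2norm v. Proof. exact: sqrtr_ge0. Qed.

Lemma l2norm_sqr v : l2norm v ^+ 2 = \sum_i v i 0 ^+ 2.
Proof. by rewrite sqr_sqrtr// sumr_ge0// => i _; exact: sqr_ge0. Qed.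

Lemma l2normZ (c : R) v : l2norm (c *: v) = `|c| * l2norm v.
Proof.
rewrite /l2norm -sqrtr_sqr -sqrtrM ?sqr_ge0// mulr_sumr; congr Num.sqrt.
by apply: eq_bigr => i _; rewrite mxE exprMn.
Qed.

Lemma l2norm_mulmx_le_opnorm A v : l2norm v <= 1 -> l2norm (A *m v) <= opnorm A.
Proof.
move=> v1; apply: (@sup_upper_bound R); last by exists v.
split; first by exists (l2norm (A *m v)), v.
(* The supremum is meaningful only for a bounded set; this crude bound holds since the entries of
   [w] are at most 1 in absolute value. *)
exists (Num.sqrt (\sum_i (\sum_j `|A i j|) ^+ 2)) => _ [w /= w1 <-].
apply: ler_wsqrtr; apply: ler_sum => i _.
rewrite -[leLHS]real_normK ?num_real// ler_sqr ?nnegrE ?sumr_ge0//.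
rewrite mxE; apply: le_trans (ler_norm_sum _ _ _) _.
apply: ler_sum => j _; rewrite normrM -[leRHS]mulr1 ler_wpM2l//.
rewrite -ler_sqr ?nnegrE// expr1n real_normK ?num_real//.
apply: (@le_trans _ _ (l2norm w ^+ 2)).
  by rewrite l2norm_sqr (bigD1 j)//= lerDl sumr_ge0// => k _; exact: sqr_ge0.
by rewrite expr_le1// l2norm_ge0.
Qed.

Lemma opnorm_ge0 A : 0 <= opnorm A.
Proof.
apply: le_trans (l2norm_ge0 (A *m 0)) (l2norm_mulmx_le_opnorm _ _ _).
by rewrite -[X in l2norm X](scale0r 0) l2normZ normr0 mul0r.
Qed.

Lemma l2norm_mulmx_le A v : l2norm (A *m v) <= opnorm A * l2norm v.
Proof.
have [v0|v0] := eqVneq (l2norm v) 0.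
  have vE : v = 0.
    apply/colP => i; rewrite mxE; apply/eqP; rewrite -sqrf_eq0.
    move: (l2norm_sqr v); rewrite v0 expr0n /= => /esym /eqP.
    rewrite psumr_eq0 => [/allP/(_ i)|j _]; last exact: sqr_ge0.
    by rewrite mem_index_enum => /(_ isT).
  by rewrite v0 mulr0 vE mulmx0 -[X in l2norm X](scale0r 0) l2normZ normr0 mul0r.
have vp : 0 < l2norm v by rewrite lt_def v0 l2norm_ge0.
have := l2norm_mulmx_le_opnorm A ((l2norm v)^-1 *: v).
rewrite l2normZ ger0_norm ?invr_ge0 ?l2norm_ge0// mulVf// => /(_ (lexx _)).
rewrite -scalemxAr l2normZ ger0_norm ?invr_ge0 ?l2norm_ge0//.
by rewrite ler_pdivrMl// mulrC.
Qed.

Lemma sum_sqr_mulmx_le A (x : 'I_n -> R) :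
  \sum_i (\sum_j A i j * x j) ^+ 2 <= opnorm A ^+ 2 * \sum_j x j ^+ 2.
Proof.
have := l2norm_mulmx_le A (\col_j x j).
rewrite -ler_sqr ?nnegrE ?mulr_ge0 ?l2norm_ge0 ?opnorm_ge0// exprMn !l2norm_sqr.
under eq_bigr do rewrite mxE; under eq_bigr do under eq_bigr do rewrite mxE.
by under [X in _ <= _ * X -> _]eq_bigr do rewrite mxE.
Qed.

Lemma opnorm_entry_diag A i : `|A i i| <= opnorm A.
Proof.
rewrite -ler_sqr ?nnegrE ?opnorm_ge0// real_normK ?num_real//.
pose e j : R := (j == i)%:R.
have e1 : \sum_j e j ^+ 2 = 1.
  rewrite (bigD1 i)//= /e eqxx big1 ?addr0 ?expr1n// => j /negPf ->.
  by rewrite expr0n.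
have Ae : \sum_j A i j * e j = A i i.
  rewrite (bigD1 i)//= /e eqxx mulr1 big1 ?addr0// => j /negPf ->.
  by rewrite mulr0.
have := sum_sqr_mulmx_le A e; rewrite e1 mulr1; apply: le_trans.
by rewrite (bigD1 i)//= Ae lerDl sumr_ge0// => j _; exact: sqr_ge0.
Qed.

Lemma norm_mxtrace_le A : `|\tr A| <= opnorm A *+ n.
Proof.
apply: le_trans (ler_norm_sum _ _ _) _.
rewrite -[X in _ *+ X]card_ord -sumr_const; apply: ler_sum => i _.
exact: opnorm_entry_diag.
Qed.

Lemma quad_formE A v : quad_form A v = \sum_i v i 0 * \sum_j A i j * v j 0.
Proof.
rewrite /quad_form -mulmxA mxE; apply: eq_bigr => i _.
by rewrite mxE; congr (_ * _); rewrite mxE.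
Qed.

Lemma quad_form_diag_off A v : quad_form A v =
  \sum_i \sum_(j | j != i) v i 0 * A i j * v j 0 + \sum_i A i i * v i 0 ^+ 2.
Proof.
rewrite quad_formE -big_split; apply: eq_bigr => i _ /=.
rewrite (bigD1 i)//= mulrDr mulr_sumr [LHS]addrC; congr (_ + _); last by ring.
by apply: eq_bigr => j _; rewrite mulrA.
Qed.

Lemma quad_form_opnorm0 A v : opnorm A = 0 -> quad_form A v = 0.
Proof.
move=> A0; rewrite quad_formE; apply: big1 => i _.
have := sum_sqr_mulmx_le A (fun j => v j 0); rewrite A0 expr0n mul0r.
rewrite (bigD1 i)//= => Av; set z := \sum_j _.
suff -> : z = 0 by rewrite mulr0.
apply/eqP; rewrite -sqrf_eq0 eq_le sqr_ge0 andbT; apply: le_trans Av.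
by rewrite lerDl sumr_ge0// => j _; exact: sqr_ge0.
Qed.

Lemma quad_form_le A v : `|quad_form A v| <= opnorm A * \sum_i v i 0 ^+ 2.
Proof.
have [A0|A0] := eqVneq (opnorm A) 0.
  by rewrite quad_form_opnorm0// normr0 A0 mul0r.
have Ap : 0 < opnorm A by rewrite lt_def A0 opnorm_ge0.
pose z i := \sum_j A i j * v j 0.
(* AM-GM: 2 |x z| <= a x^2 + z^2 / a *)
apply: (@le_trans _ _ (\sum_i (opnorm A * v i 0 ^+ 2 + (opnorm A)^-1 * z i ^+ 2) / 2)).
  rewrite quad_formE; apply: le_trans (ler_norm_sum _ _ _) _; apply: ler_sum => i _.
  rewrite -/(z i) ler_pdivlMr// -(ler_pM2l Ap) normrM.
  set a := opnorm A; rewrite [leRHS]mulrDr mulVKf//.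
  have := sqr_ge0 (a * `|v i 0| - `|z i|).
  rewrite -[v i 0 ^+ 2]real_normK ?num_real// -[z i ^+ 2]real_normK ?num_real//.
  by nra.
rewrite -mulr_suml ler_pdivrMr// big_split /= -!mulr_sumr.
have : (opnorm A)^-1 * \sum_i z i ^+ 2 <= opnorm A * \sum_i v i 0 ^+ 2.
  rewrite ler_pdivrMl// mulrA -expr2; exact: (sum_sqr_mulmx_le A (fun j => v j 0)).
by lra.
Qed.

Lemma quad_form_normalize A v :
  quad_form A (normalize v) = (\sum_i v i 0 ^+ 2)^-1 * quad_form A v.
Proof.
rewrite -l2norm_sqr -exprVn !quad_formE mulr_sumr; apply: eq_bigr => i _.
rewrite /normalize mxE; under eq_bigr do rewrite mxE.
set c := (l2norm v)^-1.
rewrite (_ : \sum_j _ = c * \sum_j A i j * v j 0); first by ring.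
by rewrite mulr_sumr; apply: eq_bigr => j _; ring.
Qed.

Lemma quad_form_normalize_le A v : `|quad_form A (normalize v)| <= opnorm A.
Proof.
rewrite quad_form_normalize; set N2 := \sum_i _.
have N20 : 0 <= N2 by apply: sumr_ge0 => i _; exact: sqr_ge0.
rewrite normrM ger0_norm ?invr_ge0//.
have [->|N2n] := eqVneq N2 0; first by rewrite invr0 mul0r opnorm_ge0.
by rewrite ler_pdivrMl ?lt_def ?N2n// mulrC; exact: quad_form_le.
Qed.

(* At v = 0 both sides vanish. *)
Lemma quad_form_normalize_shift A v (c : R) :
  \sum_i v i 0 ^+ 2 * (quad_form A (normalize v) - c) =
  quad_form A v - c * \sum_i v i 0 ^+ 2.
Proof.
rewrite -mulr_suml quad_form_normalize; set N2 := \sum_i _.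
have [N20|N2n] := eqVneq N2 0; last by rewrite mulrBr mulVKf// mulrC.
have : `|quad_form A v| <= 0 by rewrite -(mulr0 (opnorm A)) -N20 quad_form_le.
by rewrite normr_le0 => /eqP ->; rewrite N20; ring.
Qed.

End spectral_norm.

(** * Choice of a scale comparable to the psi2 norm *)

Section subgaussian_scale.
Context {d} {T : measurableType d} {R : realType} {P : probability T R}.
Context {Z : {RV P >-> R}}.
Local Open Scope ereal_scope.

Let S : set R := [set v : R | (0 < v)%R /\ 'E_P[fun w => psi2 (`|Z w| / v)] <= 1].

Let mZv (v : R) : measurable_fun setT (fun w => (Z w / v) ^+ 2)%R.
Proof. by apply: measurable_funX; exact: measurable_funM. Qed.

Lemma psi2_normE v w : psi2 (`|Z w| / v)%R = (expR ((Z w / v) ^+ 2) - 1)%R.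
Proof. by rewrite /psi2 !exprMn real_normK ?num_real. Qed.

Let S_exp v : S v -> \int[P]_w (expR ((Z w / v) ^+ 2))%:E <= 2%:E.
Proof.
move=> [v0]; rewrite unlock => Ev.
have me : measurable_fun setT (fun w => expR ((Z w / v) ^+ 2)).
  exact: measurableT_comp.
have -> : \int[P]_w (expR ((Z w / v) ^+ 2))%:E =
    \int[P]_w ((psi2 (`|Z w| / v))%:E + 1%:E).
  by apply: eq_integral => w _; rewrite -EFinD psi2_normE subrK.
rewrite ge0_integralD//; last 2 first.
- by move=> w _; rewrite lee_fin psi2_normE; have := expR_ge1Dx ((Z w / v) ^+ 2);
     have := sqr_ge0 (Z w / v); lra.
- apply/measurable_EFinP; under eq_fun do rewrite psi2_normE.
  exact: measurable_funB.
rewrite integral_probability_cst (_ : 2%:E = 1 + 1); last by rewrite -EFinD.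
exact: leeD2r.
Qed.

Let S_sqr v : S v -> \int[P]_w ((Z w / v) ^+ 2)%:E <= 1.
Proof.
move=> [v0]; rewrite unlock; apply: le_trans; apply: ge0_le_integral => //.
- by move=> w _; rewrite lee_fin sqr_ge0.
- exact/measurable_EFinP.
- apply/measurable_EFinP; under eq_fun do rewrite psi2_normE.
  by apply: measurable_funB => //; exact: measurableT_comp.
move=> w _; rewrite lee_fin psi2_normE.
by have := expR_ge1Dx ((Z w / v) ^+ 2); lra.
Qed.

Let sqrZ (v : R) : (0 < v)%R ->
  \int[P]_w (Z w ^+ 2)%:E = (v ^+ 2)%:E * \int[P]_w ((Z w / v) ^+ 2)%:E.
Proof.
move=> v0; rewrite -ge0_integralZl_EFin ?sqr_ge0//; last 2 first.
- by move=> w _; rewrite lee_fin sqr_ge0.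
- exact/measurable_EFinP.
by apply: eq_integral => w _; rewrite -EFinM; congr EFin; field; rewrite gt_eqF.
Qed.

(** An admissible [v] below twice the psi2 norm [L] is chosen. Then [s] is the variance over
    [v ^+ 2], hence at least [(4 K^2)^-1] for [K] the psi2 ratio. Moreover [x^2 <= psi2 x] puts the
    standard deviation below every admissible scale, whence [1 <= K]. *)
Lemma subgaussian_scale :
  nondegenerate_rv P Z -> 'E_P[Z] = 0 -> subgaussian P Z ->
  exists v s : R, [/\ (0 < v)%R,
    \int[P]_w (expR ((Z w / v) ^+ 2))%:E <= 2%:E,
    \int[P]_w ((Z w / v) ^+ 2)%:E = s%:E,
    (s <= 1)%R & (1 <= psi2_ratio P Z)%R /\ ((4 * psi2_ratio P Z ^+ 2)^-1 <= s)%R].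
Proof.
move=> nd EZ sg.
have psiE : psi2_norm P Z = ereal_inf [set v%:E | v in S] by [].
have [_ [v1 Sv1 <-] _] : exists2 y, [set v%:E | v in S] y & y < +oo.
  exact: ereal_inf_lt.
have v10 : (0 < v1)%R by case: Sv1.
have sqr_fin (v : R) : S v -> exists s : R,
    [/\ \int[P]_w ((Z w / v) ^+ 2)%:E = s%:E, (0 <= s)%R & (s <= 1)%R].
  move=> Sv; have le1 := S_sqr _ Sv.
  have ge0 : 0 <= \int[P]_w ((Z w / v) ^+ 2)%:E.
    by apply: integral_ge0 => w _; rewrite lee_fin sqr_ge0.
  have fn : \int[P]_w ((Z w / v) ^+ 2)%:E \is a fin_num.
    by rewrite ge0_fin_numE//; exact: le_lt_trans le1 (ltry _).
  exists (fine (\int[P]_w ((Z w / v) ^+ 2)%:E)); rewrite fineK//; split=> //.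
    exact: fine_ge0.
  by rewrite -lee_fin fineK.
have [s1 [Es1 s10 _]] := sqr_fin _ Sv1.
pose sig2 : R := (v1 ^+ 2 * s1)%R.
have Esig2 : \int[P]_w (Z w ^+ 2)%:E = sig2%:E by rewrite (sqrZ v1)// Es1.
have VZ : 'V_P[Z] = sig2%:E.
  rewrite /variance unlock EZ /= unlock -Esig2; apply: eq_integral => w _.
  by rewrite expr2 -[in RHS](subr0 (Z w)).
(* A vanishing second moment would make [Z] almost surely 0, against nondegeneracy. *)
have sig2_gt0 : (0 < sig2)%R.
  rewrite lt_def (_ : 0 <= sig2)%R ?andbT; last by rewrite /sig2 mulr_ge0 ?sqr_ge0.
  apply/eqP => sig0; apply: nd; exists 0%R.
  have mZ2 : measurable_fun setT (fun w => (Z w ^+ 2)%:E).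
    by apply/measurable_EFinP; exact: measurable_funX.
  have : \int[P]_w `|(Z w ^+ 2)%:E| = 0.
    transitivity (\int[P]_w (Z w ^+ 2)%:E); last by rewrite Esig2 sig0.
    by apply: eq_integral => w _; rewrite abse_EFin ger0_norm ?sqr_ge0.
  move/(ae_eq_integral_abs _ measurableT mZ2).
  apply: filterS => w /= /(_ I) []; move/eqP.
  by rewrite sqrf_eq0 => /eqP.
have sig2_le v : S v -> (sig2 <= v ^+ 2)%R.
  move=> Sv; have [v0 _] := Sv; have [s [Es s0 s1']] := sqr_fin _ Sv.
  move: Esig2; rewrite (sqrZ v)// Es -EFinM => -[<-].
  by rewrite ler_piMr ?sqr_ge0.
pose sig : R := Num.sqrt sig2.
have sig0 : (0 < sig)%R by rewrite sqrtr_gt0.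
have sigsq : (sig ^+ 2 = sig2)%R by rewrite sqr_sqrtr// ltW.
have lb : sig%:E <= psi2_norm P Z.
  rewrite psiE; apply: le_ereal_inf_tmp => _ [v Sv <-]; rewrite lee_fin.
  have [v0 _] := Sv; rewrite -ler_sqr ?nnegrE ?(ltW sig0) ?(ltW v0)// sigsq.
  exact: sig2_le.
have [L EL] : exists L : R, psi2_norm P Z = L%:E.
  exists (fine (psi2_norm P Z)); rewrite fineK// fin_numElt.
  by rewrite (lt_le_trans (ltNyr _) lb)/=.
have sigL : (sig <= L)%R by rewrite -lee_fin -EL.
have L0 : (0 < L)%R by exact: lt_le_trans sigL.
have KE : psi2_ratio P Z = (L / sig)%R by rewrite /psi2_ratio EL VZ.
(* The factor 2 leaves room above the infimum, as [L] is positive; its square is the 4 in the lower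
   bound on [s]. *)
have [_ [v Sv <-] vL] : exists2 y, [set v%:E | v in S] y & y < (2 * L)%:E.
  by apply: ereal_inf_lt; rewrite -psiE EL lte_fin; lra.
have [s [Es s0 s_le1]] := sqr_fin _ Sv.
have [v0 _] := Sv.
exists v, s; split => //; first exact: S_exp.
rewrite KE; split; first by rewrite ler_pdivlMr// mul1r.
have -> : s = (sig ^+ 2 / v ^+ 2)%R.
  move: Esig2; rewrite (sqrZ v)// Es -EFinM sigsq => -[<-].
  by rewrite mulrC mulKf// expf_neq0// gt_eqF.
rewrite (_ : (4 * (L / sig) ^+ 2)^-1 = sig ^+ 2 / (2 * L) ^+ 2)%R; last first.
  by field; rewrite !gt_eqF.
rewrite ler_pM2l ?exprn_gt0// lef_pV2 ?posrE ?exprn_gt0// ?mulr_gt0//.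
by rewrite ler_sqr ?nnegrE ?(ltW v0) ?mulr_ge0 ?(ltW L0)// ltW.
Qed.

End subgaussian_scale.

(** * The normalized quadratic form *)

Section same_distribution.
Local Open Scope ereal_scope.
Context {d} {T : measurableType d} {d'} {T' : measurableType d'} {R : realType}.
Context {P : probability T R} {P' : probability T' R}.
Context {X : {RV P >-> R}} {Y : {RV P' >-> R}} (XY : same_distribution X Y).

Lemma ge0_integral_same_distribution (f : R -> R) :
  measurable_fun setT f -> (forall x, 0 <= f x)%R ->
  \int[P]_w (f (X w))%:E = \int[P']_w (f (Y w))%:E.
Proof.
move=> mf f0.
have mEf : measurable_fun setT (EFin \o f) by exact/measurable_EFinP.
have Ef0 x : 0 <= (EFin \o f) x by rewrite lee_fin.
rewrite -(ge0_integral_distribution X mEf Ef0).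
rewrite -(ge0_integral_distribution Y mEf Ef0).
by apply: eq_measure_integral => B mB _; exact: XY.
Qed.

Lemma expectation_same_distribution :
  P.-integrable setT (EFin \o X) -> P'.-integrable setT (EFin \o Y) ->
  \int[P]_w (X w)%:E = \int[P']_w (Y w)%:E.
Proof.
move=> iX iY; have mE : measurable_fun setT (@EFin R) by exact/measurable_EFinP.
rewrite -(integral_distribution (X := X) mE)// -(integral_distribution (X := Y) mE)//.
by apply: eq_measure_integral => B mB _; exact: XY.
Qed.

End same_distribution.

(** * Concentration around the normalized trace *)

Section spherical_tail.
Local Open Scope ereal_scope.
Context {d} {T : measurableType d} {R : realType} {P : probability T R}.
Context {n : nat} {X : 'I_n -> {RV P >-> R}} (indX : mutually_independent X).
Context {v s : R} (v0 : (0 < v)%R).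
Hypothesis expX : forall i, \int[P]_w (expR ((X i w / v) ^+ 2))%:E <= 2%:E.
Hypothesis EX : forall i, \int[P]_w (X i w)%:E = 0.
Hypothesis VX : forall i, \int[P]_w ((X i w / v) ^+ 2)%:E = s%:E.
Hypothesis s01 : (0 <= s <= 1)%R.
Context {A : 'M[R]_n} (A0 : (0 < opnorm A)%R) (n0 : (0 < n)%N).

Let Q w := quad_form A (normalize (rvec X w)).
Let a := (\tr A / n%:R)%R.

Lemma measurable_quad_form_normalize : measurable_fun setT Q.
Proof.
rewrite /Q; under eq_fun do rewrite quad_form_normalize quad_formE.
have mX i : measurable_fun setT (fun w => rvec X w i 0)%R.
  by apply: (eq_measurable_fun (X i)) => // w _; rewrite mxE.
have mX2 : measurable_fun setT (fun w => \sum_i rvec X w i 0 ^+ 2)%R.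
  by apply: measurable_sum => i; exact: measurable_funX.
apply: measurable_funM.
  (* The inverse is written as a real power, which is measurable; the two agree on nonnegative
     reals. *)
  apply: (eq_measurable_fun (fun w => (\sum_i rvec X w i 0 ^+ 2) `^ (-1))%R).
    by move=> w _; rewrite powR_inv1// sumr_ge0// => i _; exact: sqr_ge0.
  exact: (@measurableT_comp _ _ _ _ _ _ (@powR R ^~ (-1)%R)).
apply: measurable_sum => i; apply: measurable_funM => //.
by apply: measurable_sum => j; exact: measurable_funM.
Qed.

Let norm_a : (`|a| <= opnorm A)%R.
Proof.
rewrite normrM normfV [`|n%:R|%R]ger0_norm// ler_pdivrMr ?ltr0n// mulr_natr.
exact: norm_mxtrace_le.
Qed.

(** The sign [eps] covers both tails. Multiplied by the squared length of [x], the event says that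
    the form of [eps (A - a I) - tau I] is nonnegative at [x]; off the diagonal this matrix is
    [eps A]. *)
Lemma spherical_one_sided_tail (eps tau : R) : (eps = 1 \/ eps = -1)%R ->
  (0 <= tau <= 2 * opnorm A)%R ->
  P [set w | (tau <= eps * (Q w - a))%R] <=
  (expR (- ((s * tau / (128 * opnorm A)) ^+ 2 *+ n)))%:E.
Proof.
move=> eps1 tau_bnd; have /andP[tau0 tau2] := tau_bnd.
have eps2 : (eps ^+ 2 = 1)%R by case: eps1 => ->; ring.
have epsn : (`|eps| = 1)%R by case: eps1 => ->; rewrite ?normrN normr1.
have b_beta (x : 'I_n -> R) :
    (\sum_i (\sum_j (eps * A i j) * x j) ^+ 2 <= opnorm A ^+ 2 * \sum_j x j ^+ 2)%R.
  apply: le_trans (sum_sqr_mulmx_le A x); apply: ler_sum => i _.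
  under eq_bigr do rewrite -mulrA.
  by rewrite -mulr_sumr exprMn eps2 mul1r.
(* The diagonal of the shifted matrix. By the choice of [a] it sums to [- tau n], and its entries
   are at most [1 + 1 + 2] times the operator norm. *)
pose m i : R := (eps * (A i i - a) - tau)%R.
have m_beta i : (`|m i| <= 4 * opnorm A)%R.
  apply: le_trans (ler_normB _ _) _; rewrite normrM epsn mul1r.
  have := ler_normB (A i i) a; have := opnorm_entry_diag A i.
  by rewrite (ger0_norm tau0); have := norm_a; lra.
have tr_m : (\sum_i m i = - (tau *+ #|'I_n|))%R.
  rewrite sumrB -mulr_sumr sumrB !sumr_const card_ord -/(\tr A).
  rewrite (_ : a *+ n = \tr A)%R ?subrr ?mulr0 ?sub0r//.
  by rewrite -mulr_natr /a divfK// pnatr_eq0 -lt0n.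
have := quadratic_tail indX v0 expX EX VX A0 b_beta m_beta tau tau_bnd s01 tr_m.
rewrite card_ord; apply: le_trans; apply: le_measure; rewrite ?inE.
- apply: measurable_set_ge; apply: measurable_funM => //.
  by apply: measurable_funB => //; exact: measurable_quad_form_normalize.
- apply: measurable_set_ge; apply: measurable_funD.
    apply: measurable_sum => i; apply: measurable_sum_cond => j.
    by apply: measurable_funM => //; exact: measurable_funM.
  by apply: measurable_sum => i; apply: measurable_funM => //; exact: measurable_funX.
move=> w /= tauQ; set x := rvec X w.
have xE i : (x i 0 = X i w)%R by rewrite mxE.
have N20 : (0 <= \sum_i x i 0 ^+ 2)%R by apply: sumr_ge0 => i _; exact: sqr_ge0.
suff -> : (\sum_i \sum_(j | j != i) X i w * (eps * A i j) * X j w +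
    \sum_i m i * X i w ^+ 2 =
    (\sum_i x i 0 ^+ 2) * (eps * (Q w - a) - tau))%R.
  by rewrite mulr_ge0// subr_ge0.
have := quad_form_normalize_shift A x a; rewrite -mulr_suml -/(Q w) => shift.
rewrite mulrBr mulrCA shift quad_form_diag_off.
rewrite (_ : \sum_i m i * _ = eps * \sum_i A i i * x i 0 ^+ 2 -
   (eps * a + tau) * \sum_i x i 0 ^+ 2)%R; last first.
  rewrite !mulr_sumr -sumrB; apply: eq_bigr => i _; rewrite xE /m; ring.
rewrite (_ : \sum_i \sum_(j | j != i) _ =
   eps * \sum_i \sum_(j | j != i) x i 0 * A i j * x j 0)%R; first by ring.
rewrite mulr_sumr; apply: eq_bigr => i _; rewrite mulr_sumr.
by apply: eq_bigr => j _; rewrite !xE; ring.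
Qed.

Lemma spherical_tail (tau : R) : (0 <= tau)%R ->
  P [set w | (tau <= `|Q w - a|)%R] <=
  (2 * expR (- ((s * tau / (128 * opnorm A)) ^+ 2 *+ n)))%:E.
Proof.
move=> tau0; have mQ := measurable_quad_form_normalize.
(* Beyond this level the event is empty, since [Q w] and [a] are both at most [opnorm A] in absolute
   value. *)
have [tau2|tau2] := leP tau (2 * opnorm A)%R; last first.
  rewrite (_ : [set w | _] = set0).
    by rewrite measure0 lee_fin; exact: mulr_ge0 (ler0n _ _) (expR_ge0 _).
  rewrite -subset0 => w /= le_tau.
  have := ler_normB (Q w) a; have := norm_a.
  by have := quad_form_normalize_le A (rvec X w); rewrite -/(Q w); lra.
have mset (eps : R) : measurable [set w | (tau <= eps * (Q w - a))%R].
  by apply: measurable_set_ge; apply: measurable_funM => //; exact: measurable_funB.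
apply: (@le_trans _ _ (P ([set w | (tau <= 1 * (Q w - a))%R] `|`
    [set w | (tau <= -1 * (Q w - a))%R]))).
  apply: le_measure; rewrite ?inE.
  - apply: measurable_set_ge; apply: measurableT_comp => //.
    exact: measurable_funB.
  - exact: measurableU.
  - by move=> w /=; rewrite ler_normr mul1r mulN1r => /orP.
apply: le_trans (measureU2 _ _ _) _ => //.
rewrite mulr_natl mulr2n EFinD.
by apply: leeD; apply: spherical_one_sided_tail; rewrite ?tau0//; [left|right].
Qed.

End spherical_tail.

(* The bound is extended-real-valued with x / 0 = +oo for 0 < x and
   exp(-oo) = 0, so that it is 0 when A = 0 and 0 < n. *)
Theorem theoremA1 (R : realType) :
  exists C c : R, 0 < C /\ 0 < c /\
  forall (d0 : measure_display) (T0 : measurableType d0)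
    (P0 : probability T0 R) (xi : {RV P0 >-> R}),
  nondegenerate_rv P0 xi -> ('E_P0[xi] = 0)%E -> subgaussian P0 xi ->
  forall (n : nat) (d : measure_display) (T : measurableType d)
    (P : probability T R) (X : 'I_n -> {RV P >-> R}),
  mutually_independent X -> (forall i, same_distribution (X i) xi) ->
  forall (A : 'M[R]_n) (t : R), 0 < t ->
  let y := fun w : T => normalize (rvec X w) in
  let Q := fun w : T => quad_form A (y w) in
  let K := psi2_ratio P0 xi in
  (P [set w | t%:E <= `|(Q w)%:E - 'E_P[Q]|] <=
   C%:E * expeR (- (c%:E *
     mine ((n%:R * t ^+ 2)%:E / (K ^+ 4 * opnorm A ^+ 2)%:E)
          ((n%:R * t)%:E / (K ^+ 2 * opnorm A)%:E))))%E.
Proof.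
(* Here [512 = 128 * 4]: 128 comes from [spherical_tail], and 4 from [(4 * K ^+ 2)^-1 <= s]. *)
pose c0 : R := 512^-1 ^+ 2.
have c0_gt0 : 0 < c0 by apply: exprn_gt0; rewrite invr_gt0 ltr0n.
exists (2 + expR (c0 * (2 / (1 - expR (- c0))) ^+ 2)), (c0 / 4).
set C := 2 + _; have C_gt0 : 0 < C by rewrite addr_gt0 ?ltr0n ?expR_gt0.
have c4_gt0 : 0 < c0 / 4 by rewrite divr_gt0.
split=> //; split=> //.
move=> d0 T0 P0 xi nd Exi sg n d T P X indX sameX A t t0.
pose Q w := quad_form A (normalize (rvec X w)).
pose K := psi2_ratio P0 xi.
suff bound : (P [set w | t%:E <= `|(Q w)%:E - 'E_P[Q]|] <=
   C%:E * expeR (- ((c0 / 4)%:E *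
     mine ((n%:R * t ^+ 2)%:E / (K ^+ 4 * opnorm A ^+ 2)%:E)
          ((n%:R * t)%:E / (K ^+ 2 * opnorm A)%:E))))%E by exact: bound.
have [v [s [v0 expxi Vxi s1 [K1 sK]]]] := subgaussian_scale nd Exi sg.
rewrite -/K in K1 sK.
have K0 : 0 < K by exact: lt_le_trans K1.
(* In these cases [Q] vanishes identically and the event is empty; in the others the scale [delta]
   below is positive. *)
have [degenerate|] := pselect (opnorm A = 0 \/ n = 0%N).
  have Q0 w : Q w = 0.
    case: degenerate => [A0|n0]; first exact: quad_form_opnorm0.
    by rewrite /Q quad_formE big1// => i _; have := ltn_ord i; rewrite {2}n0.
  have EQ : ('E_P[Q] = 0)%E.
    by rewrite unlock; apply: integral0_eq => w _; rewrite Q0.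
  rewrite (_ : [set w | _] = set0).
    rewrite measure0; apply: mule_ge0 (expeR_ge0 _).
    by rewrite lee_fin (ltW C_gt0).
  by rewrite -subset0 => w /=; rewrite EQ Q0 sube0 abse0 lee_fin leNgt t0.
move=> /not_orP[/eqP A_neq0 /eqP n_neq0].
have A0 : 0 < opnorm A by rewrite lt_def A_neq0 opnorm_ge0.
have n0 : (0 < n)%N by rewrite lt0n.
have nR0 : 0 < n%:R :> R by rewrite ltr0n.
have m_sqr : measurable_fun setT (fun x : R => (x / v) ^+ 2).
  by apply: measurable_funX; exact: measurable_funM.
have expX i : (\int[P]_w (expR ((X i w / v) ^+ 2))%:E <= 2%:E)%E.
  rewrite (ge0_integral_same_distribution (sameX i)
    (fun x => expR ((x / v) ^+ 2)))//.
  exact: measurableT_comp.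
have VX i : (\int[P]_w ((X i w / v) ^+ 2)%:E = s%:E)%E.
  rewrite (ge0_integral_same_distribution (sameX i) (fun x => (x / v) ^+ 2))//.
  by move=> x; exact: sqr_ge0.
have EX i : (\int[P]_w (X i w)%:E = 0)%E.
  rewrite (expectation_same_distribution (sameX i)); last 2 first.
  - exact: integrable_rv v0 (expX i).
  - exact: integrable_rv v0 expxi.
  by move: Exi; rewrite unlock.
have s0 : 0 <= s by apply: le_trans sK; rewrite invr_ge0 mulr_ge0 ?ler0n ?sqr_ge0.
have s01 : 0 <= s <= 1 by rewrite s0.
(* The scale at which the first term of the minimum becomes [(t / delta) ^+ 2]. *)
pose delta := K ^+ 2 * opnorm A / Num.sqrt n%:R.
have sqrtn0 : 0 < Num.sqrt (n%:R : R) by rewrite sqrtr_gt0.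
have delta0 : 0 < delta by rewrite divr_gt0// mulr_gt0// exprn_gt0.
have sqr_delta (u : R) : (u / delta) ^+ 2 = n%:R * u ^+ 2 / (K ^+ 4 * opnorm A ^+ 2).
  rewrite /delta -[in RHS](@sqr_sqrtr _ n%:R) ?ler0n//.
  by field; rewrite !gt_eqF.
have mQ : measurable_fun setT Q by exact: measurable_quad_form_normalize.
have QB w : `|Q w| <= opnorm A by exact: quad_form_normalize_le.
have tail (tau : R) : 0 <= tau ->
    (P [set w | (tau <= `|Q w - \tr A / n%:R|)%R] <=
     (2 * expR (- (c0 * (tau / delta) ^+ 2)))%:E)%E.
  move=> tau0.
  have := spherical_tail indX v0 expX EX VX s01 A0 n0 _ tau0.
  move=> /le_trans; apply; rewrite lee_fin ler_pM2l ?ltr0n// ler_expR lerN2.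
  rewrite sqr_delta -[leRHS]mulr_natr.
  have K2 : 0 < K ^+ 2 by exact: exprn_gt0.
  have sK2 : (16 * K ^+ 4)^-1 <= s ^+ 2.
    rewrite (_ : (16 * K ^+ 4)^-1 = (4 * K ^+ 2)^-1 ^+ 2); last first.
      by field; rewrite gt_eqF.
    by rewrite ler_sqr ?nnegrE// invr_ge0 mulr_ge0 ?ler0n ?sqr_ge0.
  pose b := (tau / (128 * opnorm A)) ^+ 2 * n%:R.
  have b0 : 0 <= b by apply: mulr_ge0 (sqr_ge0 _) (ltW nR0).
  rewrite (_ : c0 * _ = (16 * K ^+ 4)^-1 * b); last first.
    by rewrite /c0 /b; field; rewrite !gt_eqF.
  rewrite (_ : _ * n%:R = s ^+ 2 * b); last first.
    by rewrite /b; field; rewrite !gt_eqF.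
  exact: ler_wpM2r.
(* The exponent obtained is the first term of the minimum, and this is at least the minimum. *)
have := recentering _ _ _ _ _ mQ QB delta0 c0_gt0 tail t t0.
move=> /le_trans; apply.
have den1 : K ^+ 4 * opnorm A ^+ 2 != 0 by rewrite gt_eqF// mulr_gt0// exprn_gt0.
have den2 : K ^+ 2 * opnorm A != 0 by rewrite gt_eqF// mulr_gt0// exprn_gt0.
rewrite !inver (negPf den1) (negPf den2) -!EFinM -EFin_min -EFinM.
rewrite -/C lee_fin (ler_pM2l C_gt0) ler_expR lerN2.
by rewrite (ler_pM2l c4_gt0) sqr_delta ge_min lexx.
Qed.
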